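(* Let $\lambda>0$, $T>0$ and let $g$ be a continuous function on $[0,T)$. For $0<\alpha<1$ let $$c_5^{\alpha}(x,t)=-\int_x^{\infty}\int_0^t M_{\alpha/2}\left(\frac{\xi}{\lambda (t-\tau)^{\alpha/2}}\right)\frac{\xi}{\lambda (t-\tau)^{\alpha/2+1}}\,\frac{\alpha}{2}\,g(\tau)\,d\tau\,d\xi$$ be the solution to the problem $$\begin{cases} {}_0D^{\alpha}_t c_5(x,t)=\lambda^2\dfrac{\partial^2 c_5}{\partial x^2}(x,t), & 0<x<\infty,\ 0<t<T,\\ c_5(x,0)=0, & 0<x<\infty,\\ \dfrac{\partial c_5}{\partial x}(0,t)=g(t), & 0<t<T.\end{cases}$$ Then for every $x>0$ and $0<t<T$, $\lim_{\alpha\nearrow 1}c_5^{\alpha}(x,t)=w(x,t)$, where $$w(x,t)=-\lambda\int_0^t \frac{e^{-\frac{x^2}{4\lambda^2(t-\tau)}}}{\sqrt{\pi(t-\tau)}}\,g(\tau)\,d\tau$$ is the classical solution to the heat equation problem $$\begin{cases} \dfrac{\partial w}{\partial t}(x,t)=\lambda^2\dfrac{\partial^2 w}{\partial x^2}(x,t), & 0<x<\infty,\ 0<t<T,\\ w(x,0)=0, & 0<x<\infty,\\ \dfrac{\partial w}{\partial x}(0,t)=g(t), & 0<t<T.\end{cases}$$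
   Context: For $0<\alpha<1$ the Caputo derivative in $t$ is ${}_0D^{\alpha}_t u(x,t)=\frac{1}{\Gamma(1-\alpha)}\int_0^t (t-\tau)^{-\alpha}\frac{\partial u}{\partial \tau}(x,\tau)\,d\tau$. For $0<\nu<1$ the Mainardi function is $M_{\nu}(z)=\sum_{k=0}^{\infty}\frac{(-z)^k}{k!\,\Gamma(-\nu k+1-\nu)}$, with the convention $1/\Gamma=0$ at the poles of $\Gamma$. Initial and boundary values are understood as the limits as $t\searrow 0$ and $x\searrow 0$ respectively. *)

(* Defs.v *)
From mathcomp Require Import all_boot all_order all_algebra.
From mathcomp Require Import all_classical all_reals all_analysis.

Set Implicit Arguments.
Unset Strict Implicit.
Unset Printing Implicit Defensive.

Import Order.TTheory GRing.Theory Num.Theory.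
Import numFieldNormedType.Exports.

Local Open Scope ring_scope.
Local Open Scope classical_set_scope.

Definition euler_integral (R : realType) (x : R) : R :=
  \int[lebesgue_measure]_(t in `]0, +oo[) (t `^ (x - 1) * expR (- t)).

(* Gamma is continued to x <= 0 by x (x+1) ... (x+n-1) Gamma(x) = Gamma(x+n),
   with n the least natural number such that x + n > 0. At a pole the divisor
   is 0, so Gamma x = 0 and (Gamma x)^-1 = 0: the convention 1/Gamma = 0 at
   the poles needs no special case. *)
Definition Gamma (R : realType) (x : R) : R :=
  let n := if 0 < x then 0%N else (Num.truncn (- x)).+1 in
  euler_integral (x + n%:R) / \prod_(0 <= i < n) (x + i%:R).

Definition mainardi (R : realType) (nu z : R) : R :=
  limn (series (fun k : nat =>
    (- z) ^+ k / (k`!%:R * Gamma (- nu * k%:R + 1 - nu)))).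

Definition caputo (R : realType) (alpha : R) (f : R -> R) (t : R) : R :=
  (Gamma (1 - alpha))^-1 *
  \int[lebesgue_measure]_(tau in `]0, t[) ((t - tau) `^ (- alpha) * derive1 f tau).

(* [derive1] and the integral are total; this says that the derivative and the
   integral occurring in [caputo alpha f t] are genuine. *)
Definition caputo_exists (R : realType) (alpha : R) (f : R -> R) (t : R) : Prop :=
  (forall tau, 0 < tau < t -> derivable f tau 1) /\
  lebesgue_measure.-integrable `]0, t[
    (fun tau => ((t - tau) `^ (- alpha) * derive1 f tau)%:E).

Definition derivable2 (R : realType) (f : R -> R) (x : R) : Prop :=
  (\forall y \near x, derivable f y 1) /\ derivable (derive1 f) x 1.

Definition zero_initial_value (R : realType) (u : R -> R -> R) : Prop :=
  forall x, 0 < x -> u x t @[t --> 0^'+] --> (0 : R).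

Definition boundary_flux (R : realType) (T : R) (g : R -> R)
    (u : R -> R -> R) : Prop :=
  forall t, 0 < t < T -> derive1 (u ^~ t) x @[x --> 0^'+] --> g t.

Definition solves_fractional_problem (R : realType) (alpha lambda T : R)
    (g : R -> R) (u : R -> R -> R) : Prop :=
  [/\ forall x t, 0 < x -> 0 < t < T ->
        [/\ caputo_exists alpha (u x) t, derivable2 (u ^~ t) x &
            caputo alpha (u x) t = lambda ^+ 2 * derive1n 2 (u ^~ t) x],
      zero_initial_value u &
      boundary_flux T g u].

Definition solves_heat_problem (R : realType) (lambda T : R)
    (g : R -> R) (u : R -> R -> R) : Prop :=
  [/\ forall x t, 0 < x -> 0 < t < T ->
        [/\ derivable (u x) t 1, derivable2 (u ^~ t) x &
            derive1 (u x) t = lambda ^+ 2 * derive1n 2 (u ^~ t) x],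
      zero_initial_value u &
      boundary_flux T g u].

Definition c5 (R : realType) (lambda : R) (g : R -> R) (alpha x t : R) : R :=
  - \int[lebesgue_measure]_(xi in `]x, +oo[)
      \int[lebesgue_measure]_(tau in `]0, t[)
        (mainardi (alpha / 2) (xi / (lambda * (t - tau) `^ (alpha / 2))) *
         (xi / (lambda * (t - tau) `^ (alpha / 2 + 1))) *
         (alpha / 2) * g tau).

Definition heat_sol (R : realType) (lambda : R) (g : R -> R) (x t : R) : R :=
  - lambda * \int[lebesgue_measure]_(tau in `]0, t[)
      (expR (- (x ^+ 2 / (4 * lambda ^+ 2 * (t - tau)))) /
       Num.sqrt (pi * (t - tau)) * g tau).

(* Main.v *)
Require Import Defs.
From mathcomp Require Import all_boot all_order all_algebra.
From mathcomp Require Import all_classical all_reals all_analysis.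
From mathcomp Require Import measurable_realfun lebesgue_integral_under gauss_integral ring lra.

(** Both assertions concern explicit integrals and are proved on the formulas.

   The limit. Put nu = alpha / 2, so that nu increases to 1/2. The integrand of
   c5 converges pointwise, but passing to the limit under the double integral
   needs a bound on M_nu(z) that is uniform for nu close to 1/2 and decays as z
   grows; the power series shows neither. The bound comes from an
   integral representation. By the reflection formula
   1 / Gamma(1 - s) = Gamma(s) sin(pi s) / pi, valid for every s > 0 with the
   convention 1 / Gamma = 0 at the poles ([GammaV_reflection]), each coefficient
   of the series is an Euler integral, and summing under the integral sign gives
   ([mainardiE])

     pi M_nu(z) = int_0^oo e^-u u^(nu-1) e^(-y cos(pi nu))
                             sin(pi nu - y sin(pi nu)) du,   y = z u^nu.

   For nu <= 1/2 the cosine is nonnegative, so the last two factors together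
   are bounded by 1, and dominated convergence yields joint continuity in
   (nu, z) up to nu = 1/2 ([cvg_mainardi_int]). At nu = 1/2 the odd
   coefficients vanish and the series sums to e^(-z^2/4) / sqrt(pi)
   ([mainardi_half]). Three integrations by parts against the oscillation give
   |M_nu(z)| <= C / (z nu)^3 ([mainardi_int_decay]). The integrand of c5 is then
   dominated by a product a(xi) b(tau) with a(xi) = xi^-2 integrable at
   infinity and b(tau) = C (1 + (t - tau)^(-1/2)), whence convergence; in the
   limit the two integrals are exchanged and the inner one is elementary
   ([integral_gauss_flux]).

   The reflection formula itself is obtained from the sine product
   ([cvg_sine_prod], read off the integrals of cos(2 s x) cos^n x) and from the
   inequality Gamma(y + s) <= y^s Gamma(y) for 0 < s < 1 ([euler_integral_le]),
   which gives Gamma(s + n) Gamma(1 - s + n) as n!^2 / n up to a factor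
   1 + O(1/n).

   The heat problem. The solution w is a convolution in time of g with
   H(x, s) = e^(-x^2/(4 lambda^2 s)) / sqrt(pi s). For x > 0 the exponential
   beats every power of 1/s, so H extended by 0 to s <= 0 is differentiable in
   s, and the derivatives involved are bounded for x in a compact part of
   ]0, oo[; this allows differentiation under the integral over a fixed interval
   reaching beyond t, and w inherits the equation from H. The same boundedness gives the initial value. For the
   boundary condition, - lambda H_x(x, .) is an approximate identity as x tends
   to 0: it is nonnegative, of total mass tending to 1 by the Gauss integral
   ([heat_flux_mass]), and small away from s = 0 ([heat_flux_le_away]). *)

Set Implicit Arguments.
Unset Strict Implicit.
Unset Printing Implicit Defensive.

Import Order.TTheory GRing.Theory Num.Theory.
Import numFieldNormedType.Exports.

Local Open Scope ring_scope.
Local Open Scope classical_set_scope.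

(** * Integrals of reals: dominated convergence and primitives *)

Section tools.
Context {R : realType}.
Local Notation mu := (@lebesgue_measure R).

Lemma dominated_cvgR d (T : measurableType d)
    (m : {measure set T -> \bar R}) (D : set T)
    (f_ : nat -> T -> R) (f g : T -> R) :
  measurable D -> (forall n, measurable_fun D (f_ n)) ->
  (forall x, D x -> f_ n x @[n --> \oo] --> f x) ->
  m.-integrable D (EFin \o g) ->
  (forall n x, D x -> `|f_ n x| <= g x) ->
  m.-integrable D (EFin \o f) /\
  \int[m]_(x in D) f_ n x @[n --> \oo] --> \int[m]_(x in D) f x.
Proof.
move=> mD mf_ cvf ig fg.
have mf : measurable_fun D f by exact: measurable_fun_cvg mf_ cvf.
have [||||intf _ H] := @dominated_convergence _ _ _ m _ mD
  (fun n x => (f_ n x)%:E) (EFin \o f) (EFin \o g) _ _ _ ig.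
- by move=> n; apply/measurable_EFinP/mf_.
- exact/measurable_EFinP.
- by apply/aeW => x Dx; apply: cvg_EFin; [exact: nearW|exact: cvf].
- by apply/aeW => x n Dx; rewrite lee_fin; exact: fg.
split => //; apply: fine_cvg.
by rewrite fineK//; exact: integrable_fin_num.
Qed.

Lemma le_integrableR d (T : measurableType d)
    (m : {measure set T -> \bar R}) (D : set T) (f g : T -> R) :
  measurable D -> measurable_fun D f -> m.-integrable D (EFin \o g) ->
  (forall x, D x -> `|f x| <= g x) -> m.-integrable D (EFin \o f).
Proof.
move=> mD mf ig fg; apply: le_integrable ig => //; first exact/measurable_EFinP.
by move=> x Dx; rewrite lee_fin (le_trans (fg _ Dx))// ler_norm.
Qed.

Section integrableR.
Context d (T : measurableType d) (m : {measure set T -> \bar R}) (D : set T).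
Implicit Types f g : T -> R.

Lemma integrableZlR (k : R) f : m.-integrable D (EFin \o f) -> measurable D ->
  m.-integrable D (EFin \o (fun x => k * f x)).
Proof. by move=> fi mD; exact: (integrableZl mD k fi). Qed.

Lemma integrableDR f g : m.-integrable D (EFin \o f) ->
  m.-integrable D (EFin \o g) -> measurable D ->
  m.-integrable D (EFin \o (fun x => f x + g x)).
Proof. by move=> fi gi mD; exact: (integrableD mD fi gi). Qed.

Lemma integrableBR f g : m.-integrable D (EFin \o f) ->
  m.-integrable D (EFin \o g) -> measurable D ->
  m.-integrable D (EFin \o (fun x => f x - g x)).
Proof. by move=> fi gi mD; exact: (integrableB mD fi gi). Qed.

End integrableR.

Lemma FTC_segment (G h : R -> R) (a b : R) : a < b ->
  (forall x, a <= x <= b -> {for x, continuous h}) ->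
  (forall x, a <= x <= b -> is_derive x 1 G (h x)) ->
  (\int[mu]_(x in `[a, b]) (h x)%:E = (G b - G a)%:E)%E.
Proof.
move=> ab ch dG; rewrite (@continuous_FTC2 _ h G)//.
- apply: continuous_in_subspaceT => x /set_mem xuv; apply: ch.
  by move: xuv; rewrite /= in_itv.
- have cG x : a <= x <= b -> {for x, continuous G}.
    by move=> /dG [dx _]; apply: differentiable_continuous; apply/derivable1_diffP.
  split.
  + by move=> x; rewrite in_itv/= => /andP[ax xb]; have [] := dG x; rewrite // !ltW.
  + by apply: cvg_at_right_filter; apply: cG; rewrite lexx ltW.
  + by apply: cvg_at_left_filter; apply: cG; rewrite lexx ltW.
- move=> x; rewrite in_itv/= => /andP[ax xb]; rewrite derive1E.
  by have [|_ ->] := dG x; first by rewrite !ltW.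
Qed.

Section exhaustion.
Variables (D : set R) (G h : R -> R) (u v : nat -> R).
Hypothesis mD : measurable D.
Hypothesis ch : forall x, D x -> {for x, continuous h}.
Hypothesis dG : forall x, D x -> is_derive x 1 G (h x).
Hypothesis uv : forall n, u n < v n.
Hypothesis uvD : forall n, `[u n, v n] `<=` D.
Hypothesis Duv : forall x, D x -> \forall n \near \oo, u n <= x <= v n.

Let E n : (\int[mu]_(x in D) ((h \_ `[u n, v n]) x)%:E = (G (v n) - G (u n))%:E)%E.
Proof.
transitivity (\int[mu]_(x in `[u n, v n]) (h x)%:E)%E.
  rewrite -[in RHS](setIidr (@uvD n)) [RHS]integral_mkcondr.
  by apply: eq_integral => x _; rewrite restrict_EFin.
apply: FTC_segment => // x xuv.
- by apply/ch/(@uvD n); rewrite /= in_itv.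
- by apply/dG/(@uvD n); rewrite /= in_itv.
Qed.

Let cvh x : D x -> (h \_ `[u n, v n]) x @[n --> \oo] --> h x.
Proof.
move=> Dx; apply: cvg_near_cst; near=> n; rewrite patchE mem_set//=.
by rewrite in_itv/=; near: n; exact: Duv.
Unshelve. all: by end_near. Qed.

Let mh_ n : measurable_fun D h -> measurable_fun D (h \_ `[u n, v n]).
Proof.
by move=> mh; apply/measurable_restrict => //; apply: measurable_funS mh.
Qed.

(** An open, possibly unbounded, interval of integration is exhausted by the
   segments [[u n, v n]]; h may be singular at the endpoints, only its
   primitive needs limits there. *)
Lemma FTC_exhaust (A B : R) :
  mu.-integrable D (EFin \o h) ->
  G (u n) @[n --> \oo] --> A -> G (v n) @[n --> \oo] --> B ->
  \int[mu]_(x in D) h x = B - A.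
Proof.
move=> ih GA GB.
have mh : measurable_fun D h by apply/measurable_EFinP; case/integrableP: ih.
(* the truncations of h are dominated by its absolute value *)
have [||||_] := @dominated_cvgR _ _ mu D (fun n => h \_ `[u n, v n]) h
  (fun x => `|h x|) mD.
- by move=> n; exact: mh_.
- exact: cvh.
- exact: integrable_norm.
- by move=> n x Dx; rewrite patchE; case: ifP => //; rewrite normr0.
rewrite /Rintegral; under eq_fun do rewrite E.
by move=> /cvg_lim <-//; apply/cvg_lim => //; exact: cvgB.
Qed.

(** For h >= 0 a bounded primitive bounds the integrals over the exhausting
   segments, and Fatou's lemma passes this to the whole domain. *)
Lemma integrable_exhaust (C : R) :
  (forall x, D x -> 0 <= h x) -> measurable_fun D h ->
  (forall x, D x -> `|G x| <= C) ->
  mu.-integrable D (EFin \o h).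
Proof.
move=> h0 mh GC.
apply/integrableP; split; first exact/measurable_EFinP.
have -> : (\int[mu]_(x in D) `|(EFin \o h) x| =
   \int[mu]_(x in D) limn_einf (fun n => ((h \_ `[u n, v n]) x)%:E))%E.
  apply: eq_integral => x /set_mem Dx /=; rewrite ger0_norm ?h0//.
  have cv : ((h \_ `[u n, v n]) x)%:E @[n --> \oo] --> (h x)%:E.
    by apply: cvg_EFin; [exact: nearW|exact: cvh].
  by rewrite is_cvg_limn_einfE; [rewrite (cvg_lim _ cv)|apply/cvg_ex; eexists; exact: cv].
apply: (@le_lt_trans _ _ (limn_einf (fun n =>
   \int[mu]_(x in D) ((h \_ `[u n, v n]) x)%:E)%E)).
  apply: fatou => //.
  + by move=> n; apply/measurable_EFinP; exact: mh_.
  + move=> n x Dx; rewrite lee_fin patchE; case: ifP => // _; exact: h0.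
apply: (@le_lt_trans _ _ (C + C)%:E); last exact: ltry.
rewrite limn_einf_lim; apply: lime_le; first exact: is_cvg_einfs.
apply: nearW => n; apply: (@le_trans _ _ ((G (v n) - G (u n))%:E)).
  by rewrite -E; apply: ereal_inf_lbound; exists n => /=.
have Du : D (u n) by apply: (@uvD n); rewrite /= in_itv/= lexx ltW.
have Dv : D (v n) by apply: (@uvD n); rewrite /= in_itv/= lexx ltW.
rewrite lee_fin (le_trans (ler_norm _))// (le_trans (ler_normB _ _))//.
by rewrite lerD// GC.
Qed.

End exhaustion.

Lemma itv0yE (x : R) : `]0, +oo[%classic x = (0 < x) :> Prop.
Proof. by rewrite /= in_itv/= andbT. Qed.

Lemma measurable_0y (h : R -> R) :
  (forall x, 0 < x -> {for x, continuous h}) ->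
  measurable_fun (`]0, +oo[%classic : set R) h.
Proof.
move=> ch; apply: open_continuous_measurable_fun => //.
by move=> x /set_mem; rewrite itv0yE => /ch.
Qed.

(** A positive null sequence below 1/2, so that the segments shrunk by it from
   both sides are nondegenerate. *)
Let shrink (n : nat) : R := n.+3%:R^-1.

Let shrink_gt0 n : 0 < shrink n. Proof. by rewrite invr_gt0. Qed.

Let shrink_lt n : 2 * shrink n < 1.
Proof. by rewrite ltr_pdivrMr// mul1r ltr_nat. Qed.

Let cvg_shrink : shrink n @[n --> \oo] --> 0.
Proof.
have := @cvg_harmonic R; rewrite -(cvg_shiftn 2).
by under eq_fun do rewrite /harmonic/= addn2.
Qed.

Let cvg_expand : (n.+1%:R : R) @[n --> \oo] --> +oo.
Proof. by have := @cvgr_idn R; rewrite -cvg_shiftS. Qed.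

Section right_unbounded.
Variables (a : R) (G h : R -> R).
Hypothesis ch : forall x : R, a < x -> {for x, continuous h}.
Hypothesis dG : forall x : R, a < x -> is_derive x 1 G (h x).

Let u n : R := a + shrink n.
Let v (n : nat) : R := a + n.+1%:R.

Let itvE (x : R) : `]a, +oo[%classic x = (a < x) :> Prop.
Proof. by rewrite /= in_itv/= andbT. Qed.

Let uv n : u n < v n.
Proof.
by rewrite ltrD2l (@lt_le_trans _ _ 1) ?invf_lt1 ?ler1n// ltr1n.
Qed.

Let uvD n : `[u n, v n] `<=` `]a, +oo[.
Proof.
move=> x; rewrite itvE /= in_itv/= => /andP[ux _].
by rewrite (lt_le_trans _ ux)// ltrDl.
Qed.

Let cvgu : u n @[n --> \oo] --> a.
Proof.
rewrite -[X in _ --> X]addr0; apply: cvgD; [exact: cvg_cst|exact: cvg_shrink].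
Qed.

Let cvgv : v n @[n --> \oo] --> +oo.
Proof. exact: (cvg_comp _ _ cvg_expand (cvg_addrl a)). Qed.

Let Duv (x : R) : `]a, +oo[%classic x -> \forall n \near \oo, u n <= x <= v n.
Proof.
rewrite itvE => ax; near=> n; apply/andP; split; last first.
  by near: n; move/cvgryPge: cvgv; exact.
apply/ltW; near: n; exact: (cvgr_lt a).
Unshelve. all: by end_near. Qed.

Lemma FTC_oy (A B : R) :
  mu.-integrable `]a, +oo[ (EFin \o h) ->
  G x @[x --> a^'+] --> A -> G x @[x --> +oo] --> B ->
  \int[mu]_(x in `]a, +oo[) h x = B - A.
Proof.
move=> ih GA GB; apply: (@FTC_exhaust _ G h u v) => //.
- by move=> x; rewrite itvE; exact: ch.
- by move=> x; rewrite itvE; exact: dG.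
- by apply: ((cvg_at_rightP _ _ _).1 GA _ (conj _ cvgu)) => n; rewrite ltrDl.
- exact: ((cvg_pinftyP _ _).1 GB _ cvgv).
Qed.

Lemma integrable_oy (C : R) :
  (forall x : R, a < x -> 0 <= h x) -> (forall x : R, a < x -> `|G x| <= C) ->
  mu.-integrable `]a, +oo[ (EFin \o h).
Proof.
move=> h0 GC; apply: (@integrable_exhaust _ G h u v _ _ _ _ _ _ C) => //.
- by move=> x; rewrite itvE; exact: ch.
- by move=> x; rewrite itvE; exact: dG.
- by move=> x; rewrite itvE; exact: h0.
- apply: open_continuous_measurable_fun => //.
  by move=> x /set_mem; rewrite itvE => /ch.
- by move=> x; rewrite itvE; exact: GC.
Qed.

End right_unbounded.

Section open_bounded.
Variables (a b : R) (G h : R -> R).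
Hypothesis ab : a < b.
Hypothesis ch : forall x : R, a < x < b -> {for x, continuous h}.
Hypothesis dG : forall x : R, a < x < b -> is_derive x 1 G (h x).

Let u n : R := a + (b - a) * shrink n.
Let v n : R := b - (b - a) * shrink n.

Let ba_gt0 : 0 < b - a. Proof. by rewrite subr_gt0. Qed.

Let itvE (x : R) : `]a, b[%classic x = (a < x < b) :> Prop.
Proof. by rewrite /= in_itv. Qed.

Let uv n : u n < v n.
Proof.
rewrite ltrBrDr -addrA -mulr2n -mulr_natl mulrCA -ltrBrDl.
by rewrite -[ltRHS]mulr1 ltr_pM2l.
Qed.

Let uvD n : `[u n, v n] `<=` `]a, b[.
Proof.
move=> x; rewrite itvE /= in_itv/= => /andP[ux xv].
rewrite (lt_le_trans _ ux) ?ltrDl ?mulr_gt0//=.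
by rewrite (le_lt_trans xv)// ltrBlDr ltrDl mulr_gt0.
Qed.

Let cvg0 : (b - a) * shrink n @[n --> \oo] --> (0 : R).
Proof. by rewrite -[X in _ --> X](mulr0 (b - a)); apply: cvgMr. Qed.

Let cvgu : u n @[n --> \oo] --> a.
Proof.
rewrite -[X in _ --> X]addr0; apply: cvgD; [exact: cvg_cst|exact: cvg0].
Qed.

Let cvgv : v n @[n --> \oo] --> b.
Proof.
rewrite -[X in _ --> X]subr0; apply: cvgB; [exact: cvg_cst|exact: cvg0].
Qed.

Let Duv (x : R) : `]a, b[%classic x -> \forall n \near \oo, u n <= x <= v n.
Proof.
rewrite itvE => /andP[ax xb]; near=> n; apply/andP; split; apply/ltW; near: n.
- exact: (cvgr_lt a).
- exact: (cvgr_gt b).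
Unshelve. all: by end_near. Qed.

Lemma FTC_oo (A B : R) :
  mu.-integrable `]a, b[ (EFin \o h) ->
  G x @[x --> a^'+] --> A -> G x @[x --> b^'-] --> B ->
  \int[mu]_(x in `]a, b[) h x = B - A.
Proof.
move=> ih GA GB; apply: (@FTC_exhaust _ G h u v) => //.
- apply: ((cvg_at_rightP _ _ _).1 GA _ (conj _ cvgu)) => n.
  by rewrite ltrDl mulr_gt0.
- apply: ((cvg_at_leftP _ _ _).1 GB _ (conj _ cvgv)) => n.
  by rewrite ltrBlDr ltrDl mulr_gt0.
Qed.

Lemma integrable_oo (C : R) :
  (forall x : R, a < x < b -> 0 <= h x) ->
  (forall x : R, a < x < b -> `|G x| <= C) ->
  mu.-integrable `]a, b[ (EFin \o h).
Proof.
move=> h0 GC; apply: (@integrable_exhaust _ G h u v _ _ _ _ _ _ C) => //.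
apply: open_continuous_measurable_fun => //.
by move=> x /set_mem; rewrite itvE => /ch.
Qed.

End open_bounded.

End tools.

(** * Derivatives of elementary functions and the Euler integral *)

Section calculus.
Context {R : realType}.
Implicit Types (f g : R -> R) (x a b : R).

Lemma is_derive1_continuous f x a : is_derive x 1 f a -> {for x, continuous f}.
Proof.
by move=> [dx _]; apply: differentiable_continuous; apply/derivable1_diffP.
Qed.

(** The rules below restate those for function-valued operations with the
   variable abstracted, the form in which [derive1] can match them. *)
Lemma is_derive1D f g x a b : is_derive x 1 f a -> is_derive x 1 g b ->
  is_derive x 1 (fun x => f x + g x) (a + b).
Proof. by move=> df dg; apply: is_deriveD. Qed.

Lemma is_derive1B f g x a b : is_derive x 1 f a -> is_derive x 1 g b ->
  is_derive x 1 (fun x => f x - g x) (a - b).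
Proof. by move=> df dg; apply: is_deriveB. Qed.

Lemma is_derive1N f x a : is_derive x 1 f a ->
  is_derive x 1 (fun x => - f x) (- a).
Proof. by move=> df; apply: is_deriveN. Qed.

Lemma is_derive1M f g x a b : is_derive x 1 f a -> is_derive x 1 g b ->
  is_derive x 1 (fun x => f x * g x) (a * g x + f x * b).
Proof.
move=> df dg; apply: (is_derive_eq (is_deriveM df dg)).
by rewrite addrC/= [_ *: a]mulrC.
Qed.

Lemma is_derive1X f n x a : is_derive x 1 f a ->
  is_derive x 1 (fun x => f x ^+ n) (n%:R * f x ^+ n.-1 * a).
Proof.
move=> df; rewrite (_ : (fun x => f x ^+ n) = f ^+ n); last first.
  by apply/funext => y; rewrite exprfctE.
exact: is_derive_eq.
Qed.

Lemma is_derive1V f x a : f x != 0 -> is_derive x 1 f a ->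
  is_derive x 1 (fun x => (f x)^-1) (- a * (f x) ^- 2).
Proof.
move=> fx df; rewrite (_ : - a * _ = - (f x) ^- 2 *: a); last first.
  by rewrite [RHS]/(_ *: _)/= mulrC mulrN mulNr.
exact (is_deriveV fx df).
Qed.

Lemma is_derive1_expR f x a : is_derive x 1 f a ->
  is_derive x 1 (fun x => expR (f x)) (expR (f x) * a).
Proof. by move=> df; exact: is_derive1_comp. Qed.

Lemma is_derive1_sin f x a : is_derive x 1 f a ->
  is_derive x 1 (fun x => sin (f x)) (cos (f x) * a).
Proof. by move=> df; exact: is_derive1_comp. Qed.

Lemma is_derive1_cos f x a : is_derive x 1 f a ->
  is_derive x 1 (fun x => cos (f x)) (- sin (f x) * a).
Proof. by move=> df; exact: is_derive1_comp. Qed.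

Lemma is_derive1_power f x a r : 0 < f x -> is_derive x 1 f a ->
  is_derive x 1 (fun x => f x `^ r) (r * f x `^ (r - 1) * a).
Proof.
move=> fx df; have dp := is_derive1_powR r fx.
by have := is_derive1_comp dp df.
Qed.

End calculus.

(** Differentiates an expression by its syntax, leaving the derivative to be
   inferred; hypotheses on subexpressions come first. *)
Ltac derive1 := repeat first
  [ eassumption
  | notypeclasses refine (is_derive_cst _ _ _)
  | notypeclasses refine (is_derive_id _ _)
  | notypeclasses refine (is_derive1D _ _)
  | notypeclasses refine (is_derive1B _ _)
  | notypeclasses refine (is_derive1N _)
  | notypeclasses refine (is_derive1X _ _)
  | notypeclasses refine (is_derive1M _ _)
  | notypeclasses refine (is_derive1_expR _)
  | notypeclasses refine (is_derive1_sin _)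
  | notypeclasses refine (is_derive1_cos _)
  | notypeclasses refine (is_derive1_power _ _ _)
  | notypeclasses refine (is_derive1V _ _) ].

(** Leaves the equation between the computed and the announced derivative. *)
Ltac derive1_to := notypeclasses refine (is_derive_eq _ _); [derive1|].
Ltac derive1_cont := notypeclasses refine (is_derive1_continuous _); derive1.

Section gamma_integral.
Context {R : realType}.
Local Notation mu := (@lebesgue_measure R).

Lemma powR_add (x r s : R) : 0 < x -> x `^ (r + s) = x `^ r * x `^ s.
Proof. by move=> x0; rewrite powRD// (gt_eqF x0) implybT. Qed.

Lemma powR_split (x r : R) : 0 < x -> x `^ r = x * x `^ (r - 1).
Proof. by move=> x0; rewrite -{2}[x]powRr1 ?ltW// -powR_add// addrCA subrr addr0. Qed.

Lemma exprn_le_fact_expR (n : nat) (y : R) : 0 <= y -> y ^+ n <= n`!%:R * expR y.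
Proof.
move=> y0; case: n => [|n].
  by rewrite expr0 fact0 mul1r -[leLHS]expR0 ler_expR.
rewrite mulrC -ler_pdivrMr ?ltr0n ?fact_gt0//.
by rewrite (le_trans _ (expR_ge1Dxn n y0))// lerDr.
Qed.

Lemma powR_expR_bounded (a c : R) : 0 < c ->
  exists2 K : R, 0 < K & forall u, 0 <= u -> (1 + u) `^ a * expR (- (c * u)) <= K.
Proof.
move=> c0; pose m := (Num.truncn `|a|).+1.
exists (m`!%:R * expR c / c ^+ m) => [|u u0].
  by rewrite divr_gt0 ?exprn_gt0// mulr_gt0 ?expR_gt0// ltr0n fact_gt0.
have am : a <= m%:R.
  by rewrite (le_trans (ler_norm _))// ltW// truncnS_gt.
have u1 : 1 <= 1 + u by rewrite lerDl.
have c1 : 0 <= c * (1 + u) by rewrite mulr_ge0 ?(ltW c0)// addr_ge0.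
rewrite ler_pdivlMr ?exprn_gt0// expRN mulrAC ler_pdivrMr ?expR_gt0//.
apply: (@le_trans _ _ ((c * (1 + u)) ^+ m)).
  rewrite exprMn mulrC ler_wpM2l ?exprn_ge0 ?(ltW c0)//.
  by rewrite -powR_mulrn ?addr_ge0// ler_powR.
rewrite (le_trans (exprn_le_fact_expR m c1))// -mulrA -expRD.
by rewrite mulrDr mulr1.
Qed.

Lemma cvg_powR_expR (a c : R) : 0 < c ->
  u `^ a * expR (- (c * u)) @[u --> +oo] --> 0.
Proof.
move=> c0; have [K K0 HK] := powR_expR_bounded (`|a| + 1) c0.
apply: (@squeeze_cvgr _ _ _ _ (cst 0) (fun u => K * u^-1)).
- near=> u; have u0 : 0 < u by near: u; exact: nbhs_pinfty_gt.
  have u1 : 1 <= u by near: u; exact: nbhs_pinfty_ge.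
  rewrite mulr_ge0 ?powR_ge0 ?expR_ge0//= ler_pdivlMr//.
  rewrite (le_trans _ (HK u (ltW u0)))// mulrAC ler_wpM2r ?expR_ge0//.
  rewrite powRD; last by rewrite gt_eqF// addr_gt0.
  rewrite powRr1 ?addr_ge0 ?(ltW u0)// ler_pM ?powR_ge0 ?(ltW u0)//; last first.
    by rewrite lerDr.
  apply: (@le_trans _ _ (u `^ `|a|)); first by rewrite ler_powR// ler_norm.
  by rewrite ge0_ler_powR ?nnegrE// ?addr_ge0 ?(ltW u0)// lerDr.
- exact: cvg_cst.
- rewrite -[X in _ --> X](mulr0 K); apply: cvgMr.
  by apply/gtr0_cvgV0; [exact: nbhs_pinfty_gt|exact: cvg_id].
Unshelve. all: by end_near. Qed.

Lemma continuous_powR_expR (a c x : R) : 0 < x ->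
  {for x, continuous (fun u : R => u `^ a * expR (- (c * u)))}.
Proof. by move=> x0; derive1_cont. Qed.

(** The integrand is dominated by a multiple of u^(a-1) (1+u)^(-a-1), whose
   primitive (u / (1+u))^a / a is bounded. *)
Lemma integrable_powR_expR (a c : R) : 0 < a -> 0 < c ->
  mu.-integrable `]0, +oo[ (EFin \o (fun u => u `^ (a - 1) * expR (- (c * u)))).
Proof.
move=> a0 c0; have [K K0 HK] := powR_expR_bounded (a + 1) c0.
pose h (u : R) := K * (u `^ (a - 1) * (1 + u) `^ (- a - 1)).
apply: (@le_integrableR _ _ _ mu _ _ h) => //.
- by apply: measurable_0y => x; exact: continuous_powR_expR.
- apply: (@integrable_oy _ 0 (fun u => K * (a^-1 * (u `^ a * (1 + u) `^ (- a)))) _ _ _ (K * a^-1)).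
  + move=> x x0; rewrite /h; derive1_cont => //.
    by rewrite addr_gt0.
  + move=> x x0; have x1 : 0 < 1 + x by rewrite addr_gt0.
    derive1_to.
    rewrite /= (powR_split a x0) (powR_split (- a) x1).
    rewrite /h; field; by rewrite gt_eqF.
  + by move=> x x0; rewrite /h !mulr_ge0 ?powR_ge0// ltW.
  + move=> x x0; rewrite ger0_norm; last first.
      by rewrite !mulr_ge0 ?powR_ge0 ?invr_ge0 ?(ltW a0)// ltW.
    rewrite ler_pM2l// ler_piMr ?invr_ge0 ?(ltW a0)//.
    rewrite powRN ler_pdivrMr ?powR_gt0 ?addr_gt0// mul1r.
    by rewrite ge0_ler_powR ?nnegrE ?(ltW a0) ?addr_ge0 ?(ltW x0)// lerDr.
- move=> u; rewrite itv0yE => u0; have u1 : 0 < 1 + u by rewrite addr_gt0.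
  rewrite ger0_norm ?mulr_ge0 ?powR_ge0 ?expR_ge0// /h mulrCA.
  rewrite ler_wpM2l ?powR_ge0// -opprD powRN ler_pdivlMr ?powR_gt0//.
  by rewrite mulrC HK// ltW.
Qed.

Lemma integrable_euler (a : R) : 0 < a ->
  mu.-integrable `]0, +oo[ (EFin \o (fun u => u `^ (a - 1) * expR (- u))).
Proof.
move=> a0; have := integrable_powR_expR a0 (@ltr01 R).
by congr (integrable _ _ (EFin \o _)); apply/funext => u; rewrite mul1r.
Qed.

Lemma euler_integralS (x : R) : 0 < x ->
  euler_integral (x + 1) = x * euler_integral x.
Proof.
move=> x0; apply/eqP; rewrite -subr_eq0; apply/eqP.
have i1 := integrable_euler (addr_gt0 x0 ltr01).
have i2 := integrable_euler x0.
have i2' := integrableZlR x i2 (measurable_itv _).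
rewrite /euler_integral -RintegralZl// -RintegralB//.
etransitivity.
  apply: (@FTC_oy _ 0 (fun u : R => - (u `^ x * expR (- (1 * u)))) _ _ _ (- (0 * expR (- (1 * 0)))) (- 0)); last 1 first.
  - by apply: cvgN; exact: cvg_powR_expR.
  - by move=> u u0; derive1_cont.
  - by move=> u u0; derive1_to => //; rewrite addrK !mul1r; ring.
  - exact: integrableBR.
  - apply: cvgN; apply: cvgM; first exact: powR_cvg0.
    apply: cvg_at_right_filter.
    have : {for 0, continuous (fun u : R => expR (- (1 * u)))} by derive1_cont.
    exact.
by rewrite mul0r subrr.
Qed.

Lemma euler_integral1 : euler_integral (1 : R) = 1.
Proof.
etransitivity.
  apply: (@FTC_oy _ 0 (fun u : R => - expR (- u)) _ _ _ (-1) 0).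
  - by move=> u u0; derive1_cont.
  - by move=> u u0; derive1_to; rewrite subrr powRr0; ring.
  - exact: integrable_euler.
  - apply: cvgN; apply: cvg_at_right_filter; rewrite -expR0 -oppr0.
    have : {for 0, continuous (fun u : R => expR (- u))} by derive1_cont.
    by rewrite /prop_for/= /continuous_at !oppr0.
  - by rewrite -oppr0; apply: cvgN; exact: cvgr_expR.
by rewrite opprK add0r.
Qed.

Lemma euler_integral_fact (n : nat) : euler_integral (n.+1%:R : R) = n`!%:R.
Proof.
elim: n => [|n IH]; first by rewrite euler_integral1.
by rewrite -natr1 euler_integralS// IH factS natrM.
Qed.

Lemma euler_integralD_nat (x : R) (n : nat) : 0 < x ->
  euler_integral (x + n%:R) = \prod_(i < n) (x + i%:R) * euler_integral x.
Proof.
move=> x0; elim: n => [|n IH]; first by rewrite big_ord0 addr0 mul1r.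
rewrite -natr1 addrA euler_integralS; last by rewrite ltr_pwDl.
by rewrite IH big_ord_recr/= mulrA [in RHS]mulrAC mulrC mulrA mulrC mulrA.
Qed.

(** The graph of the concave function u^s lies below its tangent at y; this is
   Young's inequality for the exponents 1/s and 1/(1-s). *)
Lemma powR_tangent (s u y : R) : 0 < s < 1 -> 0 < y -> 0 <= u ->
  u `^ s <= (1 - s) * y `^ s + s * y `^ (s - 1) * u.
Proof.
move=> /andP[s0 s1] y0 u0.
have s1' : 0 < 1 - s by rewrite subr_gt0.
(* Young's inequality for (u / y) ^ s and 1 *)
have /= := @conjugate_powR R ((u / y) `^ s) 1 s^-1 (1 - s)^-1.
rewrite !invrK powR1 mul1r -powRrM divff ?gt_eqF// powRr1 ?divr_ge0 ?(ltW y0)//.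
rewrite mulr1 powR_ge0 ler01 !invr_gt0 s0 s1' addrC subrK => /(_ isT isT isT isT erefl).
rewrite powRM ?invr_ge0 ?(ltW y0)//.
rewrite -(ler_pM2r (powR_gt0 s y0)) => H.
have yy : (y^-1) `^ s * y `^ s = 1.
  by rewrite -powRM ?invr_ge0 ?(ltW y0)// mulVf ?gt_eqF// powR1.
rewrite -[in leLHS]mulrA yy mulr1 in H; rewrite (le_trans H)//.
rewrite [y `^ s](powR_split _ y0).
rewrite le_eqVlt; apply/orP; left; apply/eqP; field; by rewrite gt_eqF.
Qed.

(** Integrate the tangent bound at y against u^(y-1) e^-u: the choice of y as
   the point of tangency makes both terms multiples of Gamma(y), since
   Gamma(y+1) = y Gamma(y). *)
Lemma euler_integral_le (y s : R) : 0 < y -> 0 < s < 1 ->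
  euler_integral (y + s) <= y `^ s * euler_integral y.
Proof.
move=> y0 s01; have /andP[s0 s1] := s01.
have i0 := integrable_euler y0.
have i1 := integrable_euler (addr_gt0 y0 ltr01).
(* split as the integral of the tangent line at y *)
have -> : y `^ s * euler_integral y =
    ((1 - s) * y `^ s) * euler_integral y + (s * y `^ (s - 1)) * euler_integral (y + 1).
  rewrite euler_integralS//.
  rewrite [y `^ s](powR_split _ y0).
  by ring.
have i0' := integrableZlR ((1 - s) * y `^ s) i0 (measurable_itv _).
have i1' := integrableZlR (s * y `^ (s - 1)) i1 (measurable_itv _).
rewrite /euler_integral -RintegralZl// -RintegralZl// -RintegralD//.
apply: le_Rintegral => //.
- by apply: integrable_euler; rewrite addr_gt0.
- exact: integrableDR.
- move=> u; rewrite itv0yE => u0.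
  have -> : u `^ (y + s - 1) = u `^ (y - 1) * u `^ s.
    by rewrite -powR_add// addrAC.
  have -> : u `^ (y + 1 - 1) = u `^ (y - 1) * u.
    by rewrite addrK (powR_split _ u0) mulrC.
  have := powR_tangent s01 y0 (ltW u0).
  have : 0 <= u `^ (y - 1) * expR (- u) by rewrite mulr_ge0 ?powR_ge0 ?expR_ge0.
  move=> w0 /(ler_wpM2l w0).
  congr (_ <= _); by ring.
Qed.

End gamma_integral.

(** * The sine product and the reflection formula *)

Section sine_product.
Context {R : realType}.
Local Notation mu := (@lebesgue_measure R).
Implicit Types (s x : R) (m n : nat).

Lemma integrable_segment (h : R -> R) (a b : R) :
  (forall x, a <= x <= b -> {for x, continuous h}) ->
  mu.-integrable `[a, b] (EFin \o h).
Proof.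
move=> ch; apply: continuous_compact_integrable; first exact: segment_compact.
apply: continuous_in_subspaceT => x /set_mem; rewrite /= in_itv/=; exact: ch.
Qed.

Lemma FTC_segmentR (G h : R -> R) (a b : R) : a < b ->
  (forall x, a <= x <= b -> {for x, continuous h}) ->
  (forall x, a <= x <= b -> is_derive x 1 G (h x)) ->
  \int[mu]_(x in `[a, b]) h x = G b - G a.
Proof. by move=> ab ch dG; rewrite /Rintegral (@FTC_segment _ G). Qed.

(** The integrals behind Euler's proof of the sine product: s = 0 gives the
   Wallis integrals, n = 0 gives sin(pi s) / (2 s). *)
Definition wallis n s := \int[mu]_(x in `[0, (pi / 2)%R]) (cos (2 * s * x) * cos x ^+ n).

Let pi2_gt0 : 0 < pi / 2 :> R. Proof. by rewrite divr_gt0// pi_gt0. Qed.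

Let cwallis n s x : {for x, continuous (fun x => cos (2 * s * x) * cos x ^+ n)}.
Proof. by derive1_cont. Qed.

Let iwallis n s : mu.-integrable `[0, (pi / 2)%R]
  (EFin \o (fun x => cos (2 * s * x) * cos x ^+ n)).
Proof. by apply: integrable_segment => x _. Qed.

(** Two integrations by parts; the primitive G collects their boundary terms,
   which vanish at both ends. *)
Lemma wallisS n s :
  (n.+2%:R ^+ 2 - 4 * s ^+ 2) * wallis n.+2 s = n.+2%:R * n.+1%:R * wallis n s.
Proof.
apply/eqP; rewrite -subr_eq0; apply/eqP.
rewrite /wallis -RintegralZl// -RintegralZl// -RintegralB//; last 2 first.
- exact: integrableZlR.
- exact: integrableZlR.
pose G x := n.+2%:R * (cos x ^+ n.+1 * sin x * cos (2 * s * x))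
    - 2 * s * (sin (2 * s * x) * cos x ^+ n.+2).
transitivity (G (pi / 2) - G 0); last first.
  by rewrite /G cos_pihalf sin0 mulr0 mulr0 sin0 !expr0n/= !(mulr0, mul0r, subr0).
apply: (@FTC_segmentR G) => [//|x _|x _].
  by derive1_cont.
rewrite /G; derive1_to; have c2 := cos2Dsin2 x.
have s2 : sin x * sin x = 1 - cos x * cos x by rewrite -c2 !expr2; ring.
rewrite /= !(exprS (cos x)) -(@natr1 R n.+1) -(@natr1 R n).
transitivity ((n%:R + 1 + 1) * (cos x * (cos x * cos x ^+ n)) * cos (2 * s * x) -
  (n%:R + 1 + 1) * (n%:R + 1) * cos x ^+ n * (sin x * sin x) * cos (2 * s * x) -
  4 * s * s * cos (2 * s * x) * (cos x * (cos x * cos x ^+ n))); first by ring.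
by rewrite s2; ring.
Qed.

Lemma wallis_half s : s != 0 -> wallis 0 s = sin (pi * s) / (2 * s).
Proof.
move=> s0; rewrite /wallis.
pose G x := sin (2 * s * x) / (2 * s).
transitivity (G (pi / 2) - G 0); last first.
  rewrite /G mulr0 sin0 mul0r subr0; congr (sin _ / _); by field.
apply: (@FTC_segmentR G) => [//|x _|x _]; first by derive1_cont.
by rewrite /G; derive1_to; rewrite /= expr0; field.
Qed.

Lemma wallis00 : wallis 0 0 = pi / 2.
Proof.
rewrite /wallis.
transitivity (pi / 2 - 0 : R); last by rewrite subr0.
apply: (@FTC_segmentR (fun x => x)) => [//|x _|x _]; first by derive1_cont.
by derive1_to; rewrite /= expr0 mulr0 mul0r cos0 mulr1.
Qed.

Lemma wallis_gt0 m : 0 < wallis m.*2 0.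
Proof.
elim: m => [|m IH]; first by rewrite wallis00.
have := wallisS m.*2 0.
rewrite expr0n/= mulr0 subr0 -doubleS => /eqP.
rewrite -(mulrA m.*2.+2%:R m.*2.+2%:R) -(mulrA m.*2.+2%:R m.*2.+1%:R).
rewrite -subr_eq0 -mulrBr mulf_eq0 pnatr_eq0/= subr_eq0 => /eqP H.
by rewrite -(pmulr_rgt0 _ (ltr0Sn _ m.*2.+1)) H mulr_gt0// ltr0n.
Qed.

Lemma ge0_derive_ge0 (f f' : R -> R) (x : R) : 0 <= x ->
  (forall y, 0 <= y <= x -> is_derive y 1 f (f' y)) ->
  (forall y, 0 <= y <= x -> 0 <= f' y) -> f 0 <= f x.
Proof.
move=> x0 df f0.
have [||c] := @MVT_segment _ f f' 0 x x0.
- by move=> y; rewrite in_itv/= => /andP[y0 yx]; apply: df; rewrite !ltW.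
- apply: continuous_in_subspaceT => y /set_mem; rewrite /= in_itv/= => /df.
  exact: is_derive1_continuous.
- rewrite in_itv/= => cx fx; rewrite -subr_ge0 fx mulr_ge0 ?f0// subr0//.
Qed.

Lemma sin_le x : 0 <= x -> sin x <= x.
Proof.
move=> x0; rewrite -subr_ge0.
have := @ge0_derive_ge0 (fun x => x - sin x) (fun x => 1 - cos x) x x0.
by rewrite sin0 subr0; apply => y _; rewrite subr_ge0 cos_le1.
Qed.

Lemma normr_sin_le x : `|sin x| <= `|x|.
Proof.
wlog x0 : x / 0 <= x => [H|].
  have [|/ltW] := leP 0 x; first exact: H.
  by rewrite -oppr_ge0 => /H; rewrite sinN !normrN.
rewrite [leRHS]ger0_norm// ler_norml sin_le// andbT.
have [x1|x1] := leP x 1; last first.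
  by rewrite (le_trans _ (sin_geN1 x))// lerN2 ltW.
rewrite lerNl (@le_trans _ _ 0) ?oppr_le0//.
by rewrite sin_ge0_pi// x0 (le_trans x1)// (le_trans _ (pi_ge2 _))// ler1n.
Qed.

Lemma mulr_cos_le_sin x : 0 <= x <= pi / 2 -> x * cos x <= sin x.
Proof.
move=> /andP[x0 xpi]; rewrite -subr_ge0.
have := @ge0_derive_ge0 (fun x => sin x - x * cos x) (fun x => x * sin x) x x0.
rewrite sin0 mul0r subr0; apply => y.
  by move=> _; derive1_to; rewrite /=; ring.
move=> /andP[y0 yx]; rewrite mulr_ge0// sin_ge0_pi// y0/=.
rewrite (le_trans yx)// (le_trans xpi)// ler_pdivrMr// ler_peMr ?pi_ge0//.
by rewrite ler1n.
Qed.

(** 1 - cos(2 s x) = 2 sin(s x)^2 <= 2 s^2 x^2 and x cos x <= sin x, so that two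
   of the factors cos x absorb x^2 into sin(x)^2 = 1 - cos(x)^2. *)
Lemma wallis_near0 m s :
  `|wallis m.+1.*2 s - wallis m.+1.*2 0| <= 2 * s ^+ 2 * (wallis m.*2 0 - wallis m.+1.*2 0).
Proof.
rewrite /wallis -RintegralB// -RintegralB// -RintegralZl//; last exact: integrableBR.
apply: (le_trans (le_normr_Rintegral _ _)) => //; first exact: integrableBR.
apply: le_Rintegral => //.
- by apply: integrable_norm => //; exact: integrableBR.
- by apply: integrableZlR => //; exact: integrableBR.
- move=> x; rewrite /= in_itv/= => /andP[x0 xpi].
  rewrite mulr0 mul0r cos0 !mul1r doubleS.
  have cx0 : 0 <= cos x ^+ m.*2 by rewrite -mul2n exprM exprn_ge0// sqr_ge0.
  have -> : cos (2 * s * x) = 1 - 2 * sin (s * x) ^+ 2.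
    rewrite -mulrA mulr_natl cos_mulr2n sin2cos2 -mulr_natl; ring.
  have -> : (1 - 2 * sin (s * x) ^+ 2) * cos x ^+ m.*2.+2 - cos x ^+ m.*2.+2 =
      - ((2 * (sin (s * x) ^+ 2 * cos x ^+ 2)) * cos x ^+ m.*2).
    by rewrite !exprS; ring.
  have -> : 2 * s ^+ 2 * (cos x ^+ m.*2 - cos x ^+ m.*2.+2) =
      2 * (s ^+ 2 * (1 - cos x ^+ 2)) * cos x ^+ m.*2.
    by rewrite !exprS; ring.
  rewrite normrN ger0_norm; last first.
    by do 2 (apply: mulr_ge0 => //); apply: mulr_ge0; exact: sqr_ge0.
  rewrite ler_wpM2r// ler_pM2l// -sin2cos2 -!exprMn -ler_sqrt ?sqr_ge0// !sqrtr_sqr.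
  have c0 : 0 <= cos x.
    by apply: cos_ge0_pihalf; rewrite xpi andbT (le_trans _ x0)// oppr_le0 ltW.
  rewrite normrM (ger0_norm c0).
  apply: (le_trans (ler_wpM2r c0 (normr_sin_le _))).
  rewrite normrM -mulrA [leRHS]normrM ler_wpM2l//.
  rewrite (ger0_norm x0) [X in _ <= X]ger0_norm; last first.
    rewrite sin_ge0_pi// x0/= (le_trans xpi)// ler_pdivrMr//.
    by rewrite ler_peMr ?pi_ge0// ler1n.
  by apply: mulr_cos_le_sin; rewrite x0.
Qed.

Lemma wallis_ratio m s :
  (1 - s ^+ 2 / m.+1%:R ^+ 2) * wallis m.+1.*2 s =
  m.*2.+1%:R / m.*2.+2%:R * wallis m.*2 s.
Proof.
have H := wallisS m.*2 s.
have N0 : m.*2.+2%:R != 0 :> R by rewrite pnatr_eq0.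
have M0 : m.+1%:R != 0 :> R by rewrite pnatr_eq0.
have E2 : m.*2.+2%:R = 2 * m.+1%:R :> R by rewrite -natrM mul2n doubleS.
apply: (mulfI (expf_neq0 2 N0)).
transitivity ((m.*2.+2%:R ^+ 2 - 4 * s ^+ 2) * wallis m.+1.*2 s).
  by rewrite E2; field.
by rewrite doubleS H; field.
Qed.

Definition sine_prod n s : R := \prod_(i < n) (1 - s ^+ 2 / i.+1%:R ^+ 2).

(** The recurrence for s divided by the recurrence for 0 leaves the factor
   1 - s^2 / n^2 at each step. *)
Lemma wallis_sine_prod m s :
  wallis 0 s * wallis m.*2 0 = sine_prod m s * wallis m.*2 s * wallis 0 0.
Proof.
elim: m => [|m IH]; first by rewrite /sine_prod big_ord0 mul1r.
have H0 := wallis_ratio m 0; rewrite expr0n/= mul0r subr0 mul1r in H0.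
rewrite /sine_prod big_ord_recr/= -/(sine_prod m s) -(mulrA (sine_prod m s)).
by rewrite wallis_ratio H0 mulrCA IH; ring.
Qed.

Lemma cvg_wallis_ratio s : wallis m.*2 s / wallis m.*2 0 @[m --> \oo] --> (1 : R).
Proof.
rewrite -(cvg_shiftS (fun m => wallis m.*2 s / wallis m.*2 0)).
apply/subr_cvg0; apply: norm_cvg0.
apply: (@squeeze_cvgr _ _ _ _ (cst 0) (fun m => 2 * s ^+ 2 * harmonic m)).
- apply: nearW => m; rewrite normr_ge0/=.
  have W0 := wallis_gt0 m.+1.
  have -> : wallis m.+1.*2 s / wallis m.+1.*2 0 - 1 =
     (wallis m.+1.*2 s - wallis m.+1.*2 0) / wallis m.+1.*2 0.
    by rewrite mulrBl divff ?gt_eqF.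
  rewrite normrM [X in _ * X]gtr0_norm ?invr_gt0// ler_pdivrMr//.
  apply: (le_trans (wallis_near0 _ _)); rewrite -[leRHS]mulrA ler_wpM2l ?(mulr_ge0 _ (sqr_ge0 _))//.
  have := wallis_ratio m 0; rewrite expr0n/= mul0r subr0 mul1r => ->.
  rewrite /harmonic/=.
  have Wm := wallis_gt0 m.
  have -> : wallis m.*2 0 - m.*2.+1%:R / m.*2.+2%:R * wallis m.*2 0 =
    m.*2.+2%:R^-1 * wallis m.*2 0.
    have -> : m.*2.+1%:R = m.*2.+2%:R - 1 :> R by rewrite -[in RHS]natr1 addrK.
    have : m.*2.+2%:R != 0 :> R by rewrite pnatr_eq0.
    by move: (m.*2.+2%:R : R) => N N0; field.
  rewrite [leRHS](_ : _ = m.*2.+1%:R / m.+1%:R * (m.*2.+2%:R^-1 * wallis m.*2 0)); last by ring.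
  rewrite ler_peMl ?mulr_ge0 ?invr_ge0 ?(ltW Wm)//.
  by rewrite ler_pdivlMr ?mul1r ?ltr0n// ler_nat ltnS -addnn leq_addr.
- exact: cvg_cst.
- by rewrite -[X in _ --> X](mulr0 (2 * s ^+ 2)); apply: cvgMr; exact: cvg_harmonic.
Qed.

(** Euler's product for the sine: as m grows the weight cos^(2m) x concentrates
   at x = 0, where cos(2 s x) = 1, so wallis (2m) s / wallis (2m) 0 tends to 1. *)
Lemma cvg_sine_prod s : s != 0 ->
  sine_prod n s @[n --> \oo] --> sin (pi * s) / (pi * s).
Proof.
move=> s0.
have pi0 : pi != 0 :> R by rewrite gt_eqF ?pi_gt0.
have E : forall n, sine_prod n s * (wallis n.*2 s / wallis n.*2 0) = sin (pi * s) / (pi * s).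
  move=> n; have W0 := wallis_gt0 n.
  have := wallis_sine_prod n s; rewrite wallis00 wallis_half// => H.
  have P2 : pi / 2 != 0 :> R by rewrite gt_eqF.
  apply: (mulIf P2); apply: (mulIf (lt0r_neq0 W0)).
  transitivity (sine_prod n s * wallis n.*2 s * (pi / 2)); first by field; rewrite lt0r_neq0.
  rewrite -H; move: (sin (pi * s)) (pi : R) pi0 => S p p0; by field; rewrite s0 p0.
have cr := cvg_wallis_ratio s.
have : (sin (pi * s) / (pi * s)) / (wallis n.*2 s / wallis n.*2 0) @[n --> \oo] -->
    (sin (pi * s) / (pi * s)) / 1.
  by apply: cvgM; [exact: cvg_cst|exact: cvgV (oner_neq0 _) cr].
rewrite divr1; apply: cvg_trans; apply: near_eq_cvg.
have : \forall n \near \oo, 0 < wallis n.*2 s / wallis n.*2 0 by exact: (cvgr_gt 1).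
apply: filterS => n w0; rewrite -(E n) mulfK// gt_eqF//.
Qed.

End sine_product.

Section reflection.
Context {R : realType}.
Implicit Types s x : R.

Lemma euler_integral_ge0 x : 0 <= euler_integral x.
Proof.
by apply: Rintegral_ge0 => u _; rewrite mulr_ge0 ?powR_ge0 ?expR_ge0.
Qed.

(** Gamma at s + n and 1 - s + n is compared with Gamma at the neighbouring
   integers; the fractional powers have exponents s and 1 - s, which add up
   to 1 in the product. *)
Lemma euler_gauss_bounds (n : nat) s : 0 < s < 1 ->
  n.+1`!%:R ^+ 2 / n.+2%:R <=
    euler_integral (s + n.+1%:R) * euler_integral (1 - s + n.+1%:R)
    <= n.+1`!%:R ^+ 2 / n.+1%:R.
Proof.
have sn0 (t : R) : 0 < t -> 0 < t + n.+1%:R by move=> t0; rewrite addr_gt0.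
have upper (t : R) : 0 < t < 1 -> euler_integral (t + n.+1%:R) <= n.+1%:R `^ t * n`!%:R.
  by move=> t01; rewrite addrC -euler_integral_fact euler_integral_le.
have lower (t : R) : 0 < t < 1 -> n.+1`!%:R <= n.+2%:R `^ (1 - t) * euler_integral (t + n.+1%:R).
  move=> /andP[t0 t1]; rewrite -euler_integral_fact.
  have -> : n.+2%:R = t + n.+1%:R + (1 - t) :> R by rewrite -natr1; ring.
  have t01 : 0 < 1 - t < 1 by rewrite subr_gt0 t1 ltrBlDr ltrDl t0.
  rewrite (le_trans (euler_integral_le (sn0 _ t0) t01))//.
  rewrite ler_wpM2r ?euler_integral_ge0// ge0_ler_powR ?nnegrE ?subr_ge0 ?(ltW t1)//.
  - by rewrite ltW// sn0.
  - by rewrite addr_ge0 ?(ltW (sn0 _ t0))// subr_ge0 ltW.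
  - by rewrite lerDl subr_ge0 ltW.
move=> s01; have /andP[s0 s1] := s01.
have s01' : 0 < 1 - s < 1 by rewrite subr_gt0 s1 ltrBlDr ltrDl s0.
apply/andP; split.
  rewrite ler_pdivrMr ?ltr0n// expr2.
  apply: (le_trans (ler_pM _ _ (lower _ s01) (lower _ s01'))) => //.
  rewrite opprB addrCA subrr addr0 mulrACA -powR_add ?ltr0n// subrK powRr1 ?ler0n//.
  by rewrite mulrC.
apply: (le_trans (ler_pM _ _ (upper _ s01) (upper _ s01'))); rewrite ?euler_integral_ge0//.
rewrite mulrACA -powR_add ?ltr0n// addrCA subrr addr0 powRr1 ?ler0n// factS natrM.
have : n.+1%:R != 0 :> R by rewrite pnatr_eq0.
by move: (n.+1%:R : R) => N N0; rewrite le_eqVlt; apply/orP; left; apply/eqP; field.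
Qed.

(** Pair the factor i + 1 + s of the first product with the factor i + 1 - s of
   the second. *)
Lemma rising_sine_prod (n : nat) s :
  (\prod_(i < n) (s + i%:R)) * (\prod_(i < n) (1 - s + i%:R)) * (s + n%:R) =
  s * n`!%:R ^+ 2 * sine_prod n s.
Proof.
elim: n => [|n IH]; first by rewrite /sine_prod !big_ord0 fact0; ring.
rewrite /sine_prod !big_ord_recr/= -/(sine_prod n s).
transitivity (((\prod_(i < n) (s + i%:R)) * (\prod_(i < n) (1 - s + i%:R)) * (s + n%:R))
   * ((1 - s + n%:R) * (s + n.+1%:R))); first by ring.
rewrite IH factS natrM.
have -> : n%:R = n.+1%:R - 1 :> R by rewrite -[in RHS]natr1 addrK.
have : n.+1%:R != 0 :> R by rewrite pnatr_eq0.
by move: (n.+1%:R : R) => N N0; field.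
Qed.

(** Shifting both arguments by n turns Gamma(s) Gamma(1 - s) into the sine
   product up to the factor controlled by [euler_gauss_bounds]. *)
Lemma euler_reflection s : 0 < s < 1 ->
  euler_integral s * euler_integral (1 - s) * sin (pi * s) = pi.
Proof.
move=> s01; have /andP[s0 s1] := s01.
have pi0 : pi != 0 :> R by rewrite gt_eqF ?pi_gt0.
pose X := euler_integral s * euler_integral (1 - s).
suff : X * s * (sin (pi * s) / (pi * s)) = 1.
  rewrite -/X; move: (sin (pi * s)) (pi : R) pi0 => S p p0 H.
  by rewrite -[RHS]mulr1 -H; field; rewrite p0 (lt0r_neq0 s0).
have L : X * s * sine_prod n.+1 s @[n --> \oo] --> X * s * (sin (pi * s) / (pi * s)).
  apply: cvgMr; have := cvg_sine_prod (lt0r_neq0 s0).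
  by rewrite -(cvg_shiftS (fun n => sine_prod n s)).
apply: (cvg_unique _ L) => //.
have E n : X * s * sine_prod n s =
    (s + n%:R) * (euler_integral (s + n%:R) * euler_integral (1 - s + n%:R)) / n`!%:R ^+ 2.
  rewrite !euler_integralD_nat ?subr_gt0//.
  have F0 : n`!%:R != 0 :> R by rewrite pnatr_eq0 -lt0n fact_gt0.
  apply: (mulIf (expf_neq0 2 F0)); rewrite mulfVK ?expf_neq0//.
  transitivity (X * (s * n`!%:R ^+ 2 * sine_prod n s)); first by rewrite /X; ring.
  by rewrite -rising_sine_prod /X; ring.
apply: (@squeeze_cvgr _ _ _ _ (fun n => 1 - harmonic n) (fun n => 1 + harmonic n)).
- apply: nearW => n; rewrite E.
  have F0 : 0 < n.+1`!%:R ^+ 2 :> R by rewrite exprn_gt0// ltr0n fact_gt0.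
  have sn : 0 < s + n.+1%:R by rewrite addr_gt0.
  have /andP[lo up] := euler_gauss_bounds n s01.
  apply/andP; split.
    rewrite ler_pdivlMr//; apply: (le_trans _ (ler_wpM2l (ltW sn) lo)).
    rewrite [X in _ <= X](_ : _ = (s + n.+1%:R) / n.+2%:R * n.+1`!%:R ^+ 2); last by ring.
    rewrite ler_pM2r// ler_pdivlMr// /harmonic/=.
    have -> : (1 - n.+1%:R^-1) * n.+2%:R = n.+1%:R - n.+1%:R^-1 :> R.
      rewrite -[n.+2%:R]natr1; have : n.+1%:R != 0 :> R by rewrite pnatr_eq0.
      by move: (n.+1%:R : R) => N N0; field.
    rewrite addrC lerD2r (@le_trans _ _ 0) ?(ltW s0)//.
  rewrite ler_pdivrMr//; apply: (le_trans (ler_wpM2l (ltW sn) up)).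
  rewrite [X in X <= _](_ : _ = (s + n.+1%:R) / n.+1%:R * n.+1`!%:R ^+ 2); last by ring.
  rewrite ler_pM2r// ler_pdivrMr// /harmonic/= mulrDl mul1r mulVf ?pnatr_eq0//.
  by rewrite addrC lerD2l ltW.
- by rewrite -[X in _ --> X]subr0; apply: cvgB; [exact: cvg_cst|exact: cvg_harmonic].
- by rewrite -[X in _ --> X]addr0; apply: cvgD; [exact: cvg_cst|exact: cvg_harmonic].
Qed.

Lemma sin_pi_nat (n : nat) : sin (pi * n%:R) = 0 :> R.
Proof.
elim: n => [|n IH]; first by rewrite mulr0 sin0.
by rewrite -natr1 mulrDr mulr1 sinDpi IH oppr0.
Qed.

Lemma euler_reflection_nat (n : nat) s : 0 < s ->
  \prod_(0 <= i < n) (1 - (s + n%:R) + i%:R) * (euler_integral s * sin (pi * s)) =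
  euler_integral (s + n%:R) * sin (pi * (s + n%:R)).
Proof.
move=> s0; elim: n => [|n IH]; first by rewrite big_geq// addr0 mul1r.
rewrite big_nat_recl// -natr1 addrA euler_integralS ?ltr_pwDl//.
rewrite mulrDr mulr1 sinDpi.
have -> : \prod_(0 <= i < n) (1 - (s + n%:R + 1) + i.+1%:R) =
    \prod_(0 <= i < n) (1 - (s + n%:R) + i%:R).
  by apply: eq_bigr => i _; rewrite -natr1; ring.
by rewrite -mulrA IH; ring.
Qed.

Lemma Gamma_pos x : 0 < x -> Gamma x = euler_integral x.
Proof. by move=> x0; rewrite /Gamma x0 big_geq// addr0 divr1. Qed.

(** For s < 1 this is the reflection formula; for larger s both sides follow
   the recurrence of Gamma, and at integers both vanish, the left one because
   the divisor in the continuation of Gamma is 0. *)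
Lemma GammaV_reflection s : 0 < s ->
  (Gamma (1 - s))^-1 = euler_integral s * sin (pi * s) / pi.
Proof.
move=> s0; have pi0 : pi != 0 :> R by rewrite gt_eqF ?pi_gt0.
have base (t : R) : 0 < t < 1 -> (euler_integral (1 - t))^-1 = euler_integral t * sin (pi * t) / pi.
  move=> t01; have H := euler_reflection t01.
  have E0 : euler_integral (1 - t) != 0.
    by apply: contra_neq pi0 => E0; rewrite -H E0 mulr0 mul0r.
  apply: (mulfI E0); rewrite divff// -[LHS](divff pi0) -{1}H; ring.
have [s1|s1] := ltP s 1.
  by rewrite Gamma_pos ?subr_gt0// base ?s0.
rewrite /Gamma subr_gt0 ltNge s1/= opprB.
set n := (Num.truncn (s - 1)).+1.
have /andP[nle nlt] : n%:R <= s < n.+1%:R.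
  have := @truncn_itv R (s - 1); rewrite subr_ge0 s1 => /(_ isT).
  by rewrite /n -!natr1 lerBrDr ltrBlDr.
pose t := s - n%:R.
have sE : s = t + n%:R by rewrite /t subrK.
have t0 : 0 <= t by rewrite /t subr_ge0.
have t1 : t < 1 by rewrite /t ltrBlDr addrC natr1.
have -> : 1 - s + n%:R = 1 - t by rewrite sE; ring.
have [tE|tN] := eqVneq t 0.
  rewrite sE tE add0r sin_pi_nat mulr0 mul0r /n big_nat_recr//=.
  rewrite (_ : 1 - (Num.truncn (s - 1)).+1%:R + (Num.truncn (s - 1))%:R = 0).
    by rewrite mulr0 invr0 mulr0 invr0.
  by rewrite -natr1; ring.
have t01 : 0 < t < 1 by rewrite lt_neqAle eq_sym tN t0.
rewrite invf_div [X in X / _](_ : _ = \prod_(0 <= i < n) (1 - (t + n%:R) + i%:R)); last first.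
  by apply: eq_bigr => i _; rewrite {1}sE.
have /andP[tp _] := t01.
by rewrite base// {1 2}sE -euler_reflection_nat// mulrA.
Qed.

End reflection.

(** * The Mainardi function as an integral *)

Section taylor.
Context {R : realType}.

Lemma is_derive1_sum (n : nat) (h : nat -> R -> R) (dh : nat -> R) (x : R) :
  (forall i, is_derive x 1 (h i) (dh i)) ->
  is_derive x 1 (fun x => \sum_(i < n) h i x) (\sum_(i < n) dh i).
Proof.
move=> dH; elim: n => [|n IH].
  rewrite big_ord0 (_ : (fun x => _) = cst 0); first exact: is_derive_cst.
  by apply/funext => y; rewrite big_ord0.
rewrite big_ord_recr/= (_ : (fun x => _) = fun x => \sum_(i < n) h i x + h n x).
  by apply: is_derive1D.
by apply/funext => y; rewrite big_ord_recr.
Qed.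

(** Taylor's formula for a sequence of functions each of which is the
   derivative of the preceding one, uniformly bounded on the half-line; by
   induction on the order, integrating the bound on the derivative. *)
Lemma taylor_remainder_bound (f : nat -> R -> R) (C : R) :
  (forall k (y : R), 0 <= y -> is_derive y 1 (f k) (f k.+1 y)) ->
  (forall k (y : R), 0 <= y -> `|f k y| <= C) ->
  forall n k (y : R), 0 <= y ->
  `|f k y - \sum_(i < n) f (k + i)%N 0 * (y ^+ i / i`!%:R)| <= C * (y ^+ n / n`!%:R).
Proof.
move=> df fC; elim=> [|n IH] k y y0.
  by rewrite big_ord0 subr0 expr0 fact0 divr1 mulr1 fC.
pose g (y : R) := f k y - \sum_(i < n.+1) f (k + i)%N 0 * (y ^+ i / i`!%:R).
pose g' (y : R) := f k.+1 y - \sum_(i < n) f (k.+1 + i)%N 0 * (y ^+ i / i`!%:R).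
have factS_neq0 i : i.+1`!%:R != 0 :> R by rewrite pnatr_eq0 -lt0n fact_gt0.
have factE i : i.+1%:R / i.+1`!%:R = (i`!%:R)^-1 :> R.
  by rewrite factS natrM invfM mulrA divff ?mul1r// pnatr_eq0.
have dg (x : R) : 0 <= x -> is_derive x 1 g (g' x).
  move=> x0; rewrite /g /g'.
  rewrite [X in is_derive _ _ X](_ : _ = fun x => f k x -
     (f k 0 + \sum_(i < n) f (k.+1 + i)%N 0 * (x ^+ i.+1 / i.+1`!%:R))); last first.
    apply/funext => t; rewrite big_ord_recl/= addn0 expr0 fact0 divr1 mulr1.
    by under eq_bigr => i _ do rewrite /bump leq0n add1n addnS -addSn.
  apply: is_derive1B; first exact: df.
  have ds : is_derive x 1 (fun x => \sum_(i < n) f (k.+1 + i)%N 0 * (x ^+ i.+1 / i.+1`!%:R))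
      (\sum_(i < n) f (k.+1 + i)%N 0 * (x ^+ i / i`!%:R)).
    apply: (@is_derive1_sum n (fun i x => f (k.+1 + i)%N 0 * (x ^+ i.+1 / i.+1`!%:R))
      (fun i => f (k.+1 + i)%N 0 * (x ^+ i / i`!%:R)) x) => i.
    by derive1_to; rewrite /= -(factE i); ring.
  by apply: (is_derive_eq (is_derive1D (is_derive_cst _ _ _) ds)); rewrite add0r.
have g0 : g 0 = 0.
  rewrite /g big_ord_recl/= addn0 expr0 fact0 divr1 mulr1 big1 ?addr0 ?subrr//.
  by move=> i _; rewrite exprS mul0r mul0r mulr0.
pose b (y : R) := C * (y ^+ n.+1 / n.+1`!%:R).
have db (x : R) : is_derive x 1 b (C * (x ^+ n / n`!%:R)).
  by rewrite /b; derive1_to; rewrite /= -(factE n); ring.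
have b0 : b 0 = 0 by rewrite /b exprS mul0r mul0r mulr0.
have g'b (x : R) : 0 <= x -> `|g' x| <= C * (x ^+ n / n`!%:R) by move=> x0; exact: IH.
rewrite -/(g y) -/(b y) ler_norml; apply/andP; split.
  rewrite -subr_ge0 opprK.
  have := @ge0_derive_ge0 R (fun x => g x + b x) (fun x => g' x + C * (x ^+ n / n`!%:R)) y y0.
  rewrite b0 g0 addr0; apply => x /andP[x0 _].
    exact: (is_derive1D (dg _ x0) (db x)).
  by have := g'b x x0; rewrite ler_norml => /andP[+ _]; rewrite -subr_ge0 opprK.
rewrite -subr_ge0.
have := @ge0_derive_ge0 R (fun x => b x - g x) (fun x => C * (x ^+ n / n`!%:R) - g' x) y y0.
rewrite b0 g0 subr0; apply => x /andP[x0 _].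
  exact: (is_derive1B (db x) (dg _ x0)).
by have := g'b x x0; rewrite ler_norml => /andP[_]; rewrite -subr_ge0.
Qed.

End taylor.

Section mainardi_integral.
Context {R : realType}.
Local Notation mu := (@lebesgue_measure R).
Implicit Types (nu z u y j : R).

(** The imaginary part of e^(i j pi nu) exp(- y e^(i pi nu)). *)
Definition damped_sin nu j y : R :=
  expR (- (y * cos (pi * nu))) * sin (j * (pi * nu) - y * sin (pi * nu)).

(** Differentiation multiplies the complex exponential by - e^(i pi nu), that
   is, increments j and changes the sign. *)
Lemma is_derive_damped_sin nu j y :
  is_derive y 1 (damped_sin nu j) (- damped_sin nu (j + 1) y).
Proof.
rewrite /damped_sin; derive1_to.
have -> : (j + 1) * (pi * nu) - y * sin (pi * nu) =
    j * (pi * nu) - y * sin (pi * nu) + pi * nu by ring.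
rewrite /= (sinD _ (pi * nu)); ring.
Qed.

Lemma cos_pi_nu_ge0 nu : 0 <= nu <= 1 / 2 -> 0 <= cos (pi * nu).
Proof.
move=> /andP[nu0 nu1]; apply: cos_ge0_pihalf; apply/andP; split.
  by rewrite (@le_trans _ _ 0) ?oppr_le0 ?divr_ge0 ?mulr_ge0 ?pi_ge0.
by rewrite ler_pM2l ?pi_gt0// -[2^-1]mul1r.
Qed.

(** The range nu <= 1/2 matters here: the cosine is nonnegative, so the
   exponential is damping. *)
Lemma damped_sin_le1 nu j y : 0 <= nu <= 1 / 2 -> 0 <= y -> `|damped_sin nu j y| <= 1.
Proof.
move=> nuP y0; rewrite /damped_sin normrM ger0_norm ?expR_ge0//.
rewrite -[leRHS]mulr1 ler_pM ?expR_ge0 ?sin_max// expR_le1 oppr_le0.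
by rewrite mulr_ge0// cos_pi_nu_ge0.
Qed.

(** The k-th derivative of damped_sin nu 1 at 0. *)
Definition damped_coeff nu (k : nat) : R := (-1) ^+ k * sin (k.+1%:R * (pi * nu)).

Lemma damped_sin_taylor nu (n : nat) y : 0 <= nu <= 1 / 2 -> 0 <= y ->
  `|damped_sin nu 1 y - \sum_(i < n) damped_coeff nu i * (y ^+ i / i`!%:R)|
  <= y ^+ n / n`!%:R.
Proof.
move=> nuP y0.
have := @taylor_remainder_bound R (fun k y => (-1) ^+ k * damped_sin nu k.+1%:R y) 1.
move=> /(_ _ _ n 0%N y y0); rewrite expr0 !mul1r.
under eq_bigr => i _ do rewrite add0n.
have -> : \sum_(i < n) damped_coeff nu i * (y ^+ i / i`!%:R) =
    \sum_(i < n) (-1) ^+ i * damped_sin nu i.+1%:R 0 * (y ^+ i / i`!%:R).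
  apply: eq_bigr => i _; congr (_ * _ * _).
  by rewrite /damped_sin !mul0r subr0 oppr0 expR0 mul1r.
apply=> [k t t0|k t t0].
- rewrite exprS mulN1r mulNr -[k.+2%:R]natr1 -mulrN.
  have d := is_derive_damped_sin nu k.+1%:R t.
  apply: (is_derive_eq (is_derive1M (is_derive_cst _ _ _) d)).
  by rewrite mul0r add0r.
- by rewrite normrM normrX normrN1 expr1n mul1r damped_sin_le1.
Qed.

Lemma cvg_expn_fact y : y ^+ n / n`!%:R @[n --> \oo] --> (0 : R).
Proof. exact: (cvg_series_cvg_0 (is_cvg_series_exp_coeff y)). Qed.

Definition mainardi_integrand nu z u : R :=
  u `^ (nu - 1) * expR (- u) * damped_sin nu 1 (z * u `^ nu).

Definition mainardi_int nu z : R := \int[mu]_(u in `]0, +oo[) mainardi_integrand nu z u.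

Lemma powR_le1Dsqrt nu u : 0 <= nu <= 1 / 2 -> 0 <= u -> u `^ nu <= 1 + Num.sqrt u.
Proof.
move=> /andP[nu0 nu1] u0; have [u1|/ltW u1] := leP u 1.
  rewrite (@le_trans _ _ 1) ?lerDl ?sqrtr_ge0//.
  have <- : 1 `^ nu = 1 :> R by rewrite powR1.
  by rewrite ge0_ler_powR ?nnegrE.
rewrite -powR12_sqrt// (@le_trans _ _ (u `^ 2^-1)) ?lerDr//.
by rewrite ler_powR// -[2^-1]mul1r.
Qed.

(** For nu <= 1/2 the power u^nu is at most 1 + sqrt u, and
   z sqrt u <= z^2 / 2 + u / 2: half of e^-u suffices to control the partial
   sums of the exponential series. *)
Lemma expR_powR_le nu z u : 0 <= nu <= 1 / 2 -> 0 <= z -> 0 <= u ->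
  expR (z * u `^ nu) <= expR (z + z ^+ 2 / 2) * expR (u / 2).
Proof.
move=> nuP z0 u0; rewrite -expRD ler_expR.
apply: (le_trans (ler_wpM2l z0 (powR_le1Dsqrt nuP u0))).
rewrite mulrDr mulr1 -addrA lerD2l -{2}(sqr_sqrtr u0).
have := sqr_ge0 (z - Num.sqrt u); rewrite sqrrB; lra.
Qed.

(** Termwise integration. The partial sums differ from the damped sine by at most
   y^n / n! <= e^y, y = z u^nu, hence are dominated by u^(nu-1) e^(-u/2) up to a
   constant. *)
Lemma series_mainardi_cvg nu z : 0 < nu <= 1 / 2 -> 0 <= z ->
  \sum_(i < n) damped_coeff nu i * (z ^+ i / i`!%:R) * euler_integral (nu * i.+1%:R)
     @[n --> \oo] --> mainardi_int nu z.
Proof.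
move=> /andP[nu0 nu1] z0; have nuP : 0 <= nu <= 1 / 2 by rewrite ltW.
pose f i (u : R) := damped_coeff nu i * (z ^+ i / i`!%:R) * (u `^ (nu * i.+1%:R - 1) * expR (- u)).
have if_ i : mu.-integrable `]0, +oo[ (EFin \o f i).
  by apply: integrableZlR => //; apply: integrable_euler; rewrite mulr_gt0.
have [isum Esum] : (forall n, mu.-integrable `]0, +oo[ (EFin \o fun u => \sum_(i < n) f i u)) /\
   (forall n, \int[mu]_(u in `]0, +oo[) (\sum_(i < n) f i u) =
      \sum_(i < n) damped_coeff nu i * (z ^+ i / i`!%:R) * euler_integral (nu * i.+1%:R)).
  apply: all_and2; elim=> [|n [IH1 IH2]].
    split; last first.
      by rewrite big_ord0; under eq_Rintegral do rewrite big_ord0; rewrite Rintegral_cst// mul0r.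
    rewrite (_ : (fun u => _) = cst 0); first exact: integrable0.
    by apply/funext => u; rewrite big_ord0.
  have -> : (fun u => \sum_(i < n.+1) f i u) = (fun u => \sum_(i < n) f i u + f n u).
    by apply/funext => u; rewrite big_ord_recr.
  split; first exact: integrableDR.
  rewrite RintegralD// IH2 big_ord_recr/=; congr (_ + _).
  rewrite RintegralZl//; apply: integrable_euler; by rewrite mulr_gt0.
under eq_fun do rewrite -Esum.
have fE n u : 0 < u -> \sum_(i < n) f i u =
   u `^ (nu - 1) * expR (- u) *
   \sum_(i < n) damped_coeff nu i * ((z * u `^ nu) ^+ i / i`!%:R).
  move=> u0; rewrite mulr_sumr; apply: eq_bigr => i _; rewrite /f.
  have -> : u `^ (nu * i.+1%:R - 1) = u `^ (nu - 1) * (u `^ nu) ^+ i.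
    rewrite -powR_mulrn ?powR_ge0// -powRrM -powR_add//; congr (_ `^ _).
    by rewrite -natr1; ring.
  by rewrite exprMn; ring.
(* a partial sum is at most 1 + e^y <= 2 e^y in absolute value *)
pose g (u : R) := 2 * expR (z + z ^+ 2 / 2) * (u `^ (nu - 1) * expR (- (1 / 2 * u))).
have ig : mu.-integrable `]0, +oo[ (EFin \o g).
  by apply: integrableZlR => //; apply: integrable_powR_expR.
apply: (@dominated_cvgR _ _ _ mu _ _ _ g _ _ _ ig _).2 => //.
- by move=> n; apply/measurable_EFinP; exact: measurable_int (isum n).
- move=> u; rewrite itv0yE => u0; rewrite /mainardi_integrand.
  under eq_fun do rewrite fE//.
  apply: cvgMr; apply/subr_cvg0; apply: norm_cvg0.
  have zu0 : 0 <= z * u `^ nu by rewrite mulr_ge0 ?powR_ge0.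
  apply: (@squeeze_cvgr _ _ _ _ (cst 0) (fun n => (z * u `^ nu) ^+ n / n`!%:R)).
  + by apply: nearW => n; rewrite normr_ge0/= distrC damped_sin_taylor.
  + exact: cvg_cst.
  + exact: cvg_expn_fact.
- move=> n u; rewrite itv0yE => u0; rewrite fE// normrM ger0_norm; last first.
    by rewrite mulr_ge0 ?powR_ge0 ?expR_ge0.
  have zu0 : 0 <= z * u `^ nu by rewrite mulr_ge0 ?powR_ge0.
  apply: (@le_trans _ _ (u `^ (nu - 1) * expR (- u) * (2 * expR (z * u `^ nu)))).
    rewrite ler_wpM2l ?mulr_ge0 ?powR_ge0 ?expR_ge0//.
    have := damped_sin_taylor n nuP zu0.
    have := damped_sin_le1 1 nuP zu0.
    have : (z * u `^ nu) ^+ n / n`!%:R <= expR (z * u `^ nu).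
      by rewrite ler_pdivrMr ?ltr0n ?fact_gt0// [leRHS]mulrC exprn_le_fact_expR.
    have : 1 <= expR (z * u `^ nu) by rewrite -expR0 ler_expR.
    move: (\sum_(i < n) _) (damped_sin _ _ _) (expR (_ * _)) (_ / _) => A B C D.
    rewrite !ler_norml; lra.
  rewrite /g [leRHS](_ : _ = u `^ (nu - 1) * expR (- u) * (2 * (expR (z + z ^+ 2 / 2) * expR (u / 2)))).
    rewrite ler_wpM2l ?mulr_ge0 ?powR_ge0 ?expR_ge0// ler_wpM2l//.
    by rewrite expR_powR_le// ltW.
  have -> : expR (- (1 / 2 * u)) = expR (- u) * expR (u / 2) by rewrite -expRD; congr expR; field.
  ring.
Qed.

(** By the reflection formula 1 / Gamma(1 - nu (k+1)) is the Euler integral at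
   nu (k+1) times sin(pi nu (k+1)) / pi. *)
Lemma mainardiE nu z : 0 < nu <= 1 / 2 -> 0 <= z -> mainardi nu z = mainardi_int nu z / pi.
Proof.
move=> nuP z0; have /andP[nu0 nu1] := nuP; apply/cvg_lim => //.
rewrite (_ : series _ = fun n =>
  (\sum_(i < n) damped_coeff nu i * (z ^+ i / i`!%:R) * euler_integral (nu * i.+1%:R)) / pi).
  by apply: cvgMl; exact: series_mainardi_cvg.
apply/funext => n; rewrite /series/= big_mkord mulr_suml; apply: eq_bigr => k _.
rewrite (_ : - nu * k%:R + 1 - nu = 1 - nu * k.+1%:R); last by rewrite -natr1; ring.
rewrite invfM GammaV_reflection ?mulr_gt0// /damped_coeff [(- z) ^+ k]exprNn.
rewrite (_ : pi * (nu * k.+1%:R) = k.+1%:R * (pi * nu)); last by ring.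
ring.
Qed.

End mainardi_integral.

(** * Decay of the Mainardi function *)

Section mainardi_decay.
Context {R : realType}.
Local Notation mu := (@lebesgue_measure R).
Implicit Types (nu z u y j : R).

Lemma powR_le1 (a u : R) : 0 <= a -> 0 <= u <= 1 -> u `^ a <= 1.
Proof.
move=> a0 /andP[u0 u1]; have : u `^ a <= 1 `^ a by rewrite ge0_ler_powR ?nnegrE.
by rewrite powR1.
Qed.

(** What remains under the integral sign after three integrations by parts: the
   derivative of the amplitude of the third term of [parts_primitive]. *)
Definition parts_kernel nu u : R :=
  expR (- u) * ((1 - nu) * (1 - 2 * nu) * u `^ (- (2 * nu))
    - 3 * (1 - nu) * u `^ (1 - 2 * nu) + u `^ (2 - 2 * nu)).

Definition parts_bound nu u : R :=
  (1 - nu) * (1 - 2 * nu) * (u `^ ((1 - 2 * nu) - 1) * expR (- u)) +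
  (3 * (1 - nu) * (u `^ ((2 - 2 * nu) - 1) * expR (- u)) +
  u `^ ((3 - 2 * nu) - 1) * expR (- u)).

Lemma integrable_parts_bound nu : 0 < nu < 1 / 2 ->
  mu.-integrable `]0, +oo[ (EFin \o parts_bound nu).
Proof.
move=> /andP[nu0 nu1].
have i1 := @integrable_euler R (1 - 2 * nu).
have i2 := @integrable_euler R (2 - 2 * nu).
have i3 := @integrable_euler R (3 - 2 * nu).
apply: integrableDR => //; first by apply: integrableZlR => //; apply: i1; lra.
apply: integrableDR => //; first by apply: integrableZlR => //; apply: i2; lra.
by apply: i3; lra.
Qed.

Lemma parts_kernel_le nu u : 0 < nu < 1 / 2 -> 0 < u ->
  `|parts_kernel nu u| <= parts_bound nu u.
Proof.
move=> /andP[nu0 nu1] u0; rewrite /parts_kernel /parts_bound.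
rewrite (_ : 1 - 2 * nu - 1 = - (2 * nu)); last by ring.
rewrite (_ : 2 - 2 * nu - 1 = 1 - 2 * nu); last by ring.
rewrite (_ : 3 - 2 * nu - 1 = 2 - 2 * nu); last by ring.
rewrite normrM ger0_norm ?expR_ge0//.
have p1 := powR_ge0 u (- (2 * nu)).
have p2 := powR_ge0 u (1 - 2 * nu).
have p3 := powR_ge0 u (2 - 2 * nu).
have a0 : 0 <= (1 - nu) * (1 - 2 * nu) by apply: mulr_ge0; lra.
have b0 : 0 <= 3 * (1 - nu) by lra.
rewrite [leRHS](_ : _ = expR (- u) * ((1 - nu) * (1 - 2 * nu) * u `^ (- (2 * nu))
    + 3 * (1 - nu) * u `^ (1 - 2 * nu) + u `^ (2 - 2 * nu))); last by ring.
rewrite ler_wpM2l ?expR_ge0//.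
have := mulr_ge0 a0 p1; have := mulr_ge0 b0 p2.
rewrite ler_norml; move: (_ * u `^ _) (_ * u `^ _) (u `^ _) p3 => A B C *.
by apply/andP; split; lra.
Qed.

(** The first term alone would be Gamma(1 - 2 nu), unbounded as nu tends to 1/2;
   its factor 1 - 2 nu turns it into Gamma(2 - 2 nu) <= Gamma(1) + Gamma(2).
   This is what makes the decay uniform up to nu = 1/2. *)
Lemma integral_parts_bound_le nu : 0 < nu < 1 / 2 ->
  \int[mu]_(u in `]0, +oo[) parts_bound nu u <= 12.
Proof.
move=> /andP[nu0 nu1].
have i1 := @integrable_euler R (1 - 2 * nu).
have i2 := @integrable_euler R (2 - 2 * nu).
have i3 := @integrable_euler R (3 - 2 * nu).
rewrite RintegralD//; last 2 first.
- by apply: integrableZlR => //; apply: i1; lra.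
- apply: integrableDR => //; first by apply: integrableZlR => //; apply: i2; lra.
  by apply: i3; lra.
rewrite RintegralD//; last 2 first.
- by apply: integrableZlR => //; apply: i2; lra.
- by apply: i3; lra.
rewrite RintegralZl//; last by apply: i1; lra.
rewrite RintegralZl//; last by apply: i2; lra.
rewrite -!/(euler_integral _).
rewrite (_ : 3 - 2 * nu = (2 - 2 * nu) + 1); last by ring.
rewrite euler_integralS; last lra.
have e2 : euler_integral (2 - 2 * nu) = (1 - 2 * nu) * euler_integral (1 - 2 * nu).
  by rewrite (_ : 2 - 2 * nu = (1 - 2 * nu) + 1) ?euler_integralS//; [lra|ring].
have e2le : euler_integral (2 - 2 * nu) <= 2.
  rewrite [leRHS](_ : _ = euler_integral 1 + euler_integral 2); last first.
    by rewrite (euler_integral_fact 1) euler_integral1 factS fact0.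
  rewrite /euler_integral -RintegralD//; try by apply: integrable_euler.
  apply: le_Rintegral => //; first by apply: i2; lra.
    by apply: integrableDR => //; apply: integrable_euler.
  move=> u; rewrite itv0yE => u0; rewrite -mulrDl ler_wpM2r ?expR_ge0//.
  rewrite subrr powRr0 (_ : 2 - 1 = 1 :> R) ?powRr1 ?(ltW u0)//; last by ring.
  have [u1|u1] := leP u 1.
    rewrite (@le_trans _ _ 1) ?lerDl ?(ltW u0)//.
    by rewrite powR_le1 ?(ltW u0)//; lra.
  rewrite (@le_trans _ _ u) ?lerDr//.
  by rewrite -[leRHS]powRr1 ?(ltW u0)// ler_powR ?(ltW u1)//; lra.
rewrite -(mulrA (1 - nu)) -e2.
have := @euler_integral_ge0 R (2 - 2 * nu).
move: (euler_integral (2 - 2 * nu)) e2le => E E2 E0; nra.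
Qed.

(** The boundary terms of three integrations by parts, each using
   u^(nu-1) damped_sin nu (j+1) (z u^nu)
     = - (z nu)^-1 d/du damped_sin nu j (z u^nu).
   The first vanishes at u = 0 because damped_sin nu 0 0 = 0. *)
Definition parts_primitive nu z u : R :=
  - (z * nu)^-1 * (expR (- u) * damped_sin nu 0 (z * u `^ nu)) +
  (z * nu) ^- 2 * (expR (- u) * u `^ (1 - nu) * damped_sin nu (-1) (z * u `^ nu)) +
  (z * nu) ^- 3 * (expR (- u) * ((1 - nu) * u `^ (1 - 2 * nu) - u `^ (2 - 2 * nu))
     * damped_sin nu (-2) (z * u `^ nu)).

Lemma is_derive_damped_sin_powR nu j z u : 0 < u ->
  is_derive u 1 (fun u => damped_sin nu j (z * u `^ nu))
    (- damped_sin nu (j + 1) (z * u `^ nu) * (z * (nu * u `^ (nu - 1)))).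
Proof.
move=> u0; have d := is_derive_damped_sin nu j (z * u `^ nu).
have dz : is_derive u 1 (fun u => z * u `^ nu) (z * (nu * u `^ (nu - 1))).
  by derive1_to; rewrite /=; ring.
by have := @is_derive1_comp _ (damped_sin nu j) (fun u => z * u `^ nu) u _ _ d dz.
Qed.

Lemma is_derive_parts_primitive nu z u : 0 < nu -> 0 < z -> 0 < u ->
  is_derive u 1 (parts_primitive nu z)
    (mainardi_integrand nu z u + (z * nu) ^- 3 * (parts_kernel nu u * damped_sin nu (-2) (z * u `^ nu))).
Proof.
move=> nu0 z0 u0.
have d0 := is_derive_damped_sin_powR nu 0 z u0.
have d1 := is_derive_damped_sin_powR nu (-1) z u0.
have d2 := is_derive_damped_sin_powR nu (-2) z u0.
rewrite add0r in d0; rewrite addNr in d1.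
rewrite (_ : -2 + 1 = -1 :> R) in d2; last by ring.
rewrite /parts_primitive; derive1_to.
rewrite /mainardi_integrand /parts_kernel /=.
rewrite (_ : 1 - nu - 1 = - nu); last by ring.
rewrite (_ : 1 - 2 * nu - 1 = - (2 * nu)); last by ring.
rewrite (_ : 2 - 2 * nu - 1 = 1 - 2 * nu); last by ring.
have P1 : u `^ (1 - nu) = u `^ (nu - 1) * u `^ (2 - 2 * nu).
  by rewrite -powR_add//; congr (_ `^ _); ring.
have P2 : u `^ (- nu) = u `^ (nu - 1) * u `^ (1 - 2 * nu).
  by rewrite -powR_add//; congr (_ `^ _); ring.
(* all powers are expressed by u^(nu-1), u^(1-2nu) and u^(2-2nu), of which the
   first and the last are tied by this relation *)
have P3 : u `^ (nu - 1) * (u `^ (nu - 1) * u `^ (2 - 2 * nu)) = 1.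
  by rewrite -!powR_add// (_ : nu - 1 + (nu - 1 + (2 - 2 * nu)) = 0) ?powRr0//; ring.
rewrite P1 P2.
move: (damped_sin nu 0 _) (damped_sin nu (-1) _) (damped_sin nu (-2) _) (damped_sin nu 1 _) => S0 S1 S2 S3.
move: (u `^ (nu - 1)) (u `^ (1 - 2 * nu)) (u `^ (2 - 2 * nu)) (u `^ (- (2 * nu))) (expR (- u)) P3 => A B C D E P3.
have z0' := lt0r_neq0 z0; have nu0' := lt0r_neq0 nu0.
transitivity (E * A * S3 + (z * nu)^-1 * E * S0 * (1 - A * (A * C)) +
  (z * nu) ^- 2 * (A * E * (B * (1 - nu) - C) * S1 * (1 - 1)) +
  (z * nu) ^- 3 * (E * ((1 - nu) * (1 - 2 * nu) * D - 3 * (1 - nu) * B + C) * S2)).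
  by field; rewrite z0' nu0'.
by rewrite P3; ring.
Qed.

Lemma cvg0_mul_bounded (F : set_system R) (p q : R -> R) : Filter F ->
  p @ F --> (0 : R) -> (\forall u \near F, `|q u| <= 1) -> p u * q u @[u --> F] --> (0 : R).
Proof.
move=> FF p0 q1; apply: norm_cvg0.
apply: (@squeeze_cvgr _ _ _ _ (cst 0) (fun u => `|p u|)).
- near=> u; rewrite normr_ge0/= normrM ler_piMr//.
  by near: u.
- exact: cvg_cst.
- by rewrite -(@normr0 _ R); apply: cvg_norm.
Unshelve. all: by end_near. Qed.

Lemma cvg_parts_primitive_0 nu z : 0 < nu < 1 / 2 -> 0 < z ->
  parts_primitive nu z u @[u --> 0^'+] --> (0 : R).
Proof.
move=> /andP[nu0 nu1] z0.
have cS j : damped_sin nu j (z * u `^ nu) @[u --> 0^'+] --> damped_sin nu j 0.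
  apply: (@cvg_comp _ _ _ (fun u => z * u `^ nu) (damped_sin nu j) _ (nbhs (0 : R))).
    have : z * u `^ nu @[u --> 0^'+] --> z * 0 by apply: cvgMr; exact: powR_cvg0.
    by rewrite mulr0.
  exact: is_derive1_continuous (is_derive_damped_sin nu j 0).
have cE : expR (- u) @[u --> (0 : R)^'+] --> expR (- (0 : R)).
  apply: cvg_at_right_filter.
  have : {for 0, continuous (fun u : R => expR (- u))} by derive1_cont.
  exact.
rewrite [X in _ --> X](_ : 0 = - (z * nu)^-1 * (expR (- 0) * damped_sin nu 0 0) +
  (z * nu) ^- 2 * (expR (- 0) * 0 * damped_sin nu (-1) 0) +
  (z * nu) ^- 3 * (expR (- 0) * ((1 - nu) * 0 - 0) * damped_sin nu (-2) 0)); last first.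
  by rewrite {1}/damped_sin !mul0r subrr sin0; ring.
apply: cvgD; [apply: cvgD|]; apply: cvgMr; apply: cvgM => //.
- by apply: cvgM => //; apply: powR_cvg0; lra.
- apply: cvgM => //; apply: cvgB; last by apply: powR_cvg0; lra.
  by apply: cvgMr; apply: powR_cvg0; lra.
Qed.

Lemma cvg_parts_primitive_y nu z : 0 < nu < 1 / 2 -> 0 < z ->
  parts_primitive nu z u @[u --> +oo] --> (0 : R).
Proof.
move=> /andP[nu0 nu1] z0.
have nuP : 0 <= nu <= 1 / 2 by rewrite !ltW.
have S1 j : \forall u \near +oo, `|damped_sin nu j (z * u `^ nu)| <= 1.
  by near=> u; rewrite damped_sin_le1// mulr_ge0 ?powR_ge0 ?ltW.
have cp a : expR (- u) * u `^ a @[u --> +oo] --> (0 : R).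
  have := @cvg_powR_expR R a 1 ltr01; apply: cvg_trans; apply: near_eq_cvg.
  by apply: nearW => u; rewrite mul1r mulrC.
have cE : expR (- u) @[u --> +oo] --> (0 : R) by exact: cvgr_expR.
rewrite (_ : 0 = - (z * nu)^-1 * 0 + (z * nu) ^- 2 * 0 + (z * nu) ^- 3 * 0); last by ring.
apply: cvgD; [apply: cvgD|]; apply: cvgMr; apply: cvg0_mul_bounded => //.
under eq_fun do rewrite mulrBr mulrCA.
rewrite (_ : 0 = (1 - nu) * 0 - 0); last by ring.
by apply: cvgB => //; apply: cvgMr.
Unshelve. all: by end_near. Qed.

(** Two integrations by parts would give only z^-2, which leaves xi^-1 in the
   integrand of c5, not integrable at infinity; hence the third. *)
Lemma mainardi_int_decay nu z : 0 < nu < 1 / 2 -> 0 < z ->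
  `|mainardi_int nu z| <= 12 / (z * nu) ^+ 3.
Proof.
move=> nuP z0; have /andP[nu0 nu1] := nuP.
have nuP' : 0 <= nu <= 1 / 2 by rewrite !ltW.
have zu0 u : 0 <= z * u `^ nu by rewrite mulr_ge0 ?powR_ge0 ?ltW.
have cd j u : 0 < u -> {for u, continuous (fun u => damped_sin nu j (z * u `^ nu))}.
  by move=> u0; apply: is_derive1_continuous (is_derive_damped_sin_powR _ _ _ u0).
have cI u : 0 < u -> {for u, continuous (mainardi_integrand nu z)}.
  move=> u0; have d0 := is_derive_damped_sin_powR nu 1 z u0.
  by rewrite /mainardi_integrand; derive1_cont.
have cK u : 0 < u -> {for u, continuous (fun u => parts_kernel nu u * damped_sin nu (-2) (z * u `^ nu))}.
  move=> u0; have d0 := is_derive_damped_sin_powR nu (-2) z u0.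
  by rewrite /parts_kernel; derive1_cont.
have iI : mu.-integrable `]0, +oo[ (EFin \o mainardi_integrand nu z).
  apply: (le_integrableR _ _ (integrable_euler nu0)) => //; first exact: measurable_0y.
  move=> u; rewrite itv0yE => u0; rewrite normrM ger0_norm ?mulr_ge0 ?powR_ge0 ?expR_ge0//.
  by rewrite ler_piMr ?mulr_ge0 ?powR_ge0 ?expR_ge0// damped_sin_le1.
have iK : mu.-integrable `]0, +oo[
    (EFin \o (fun u => parts_kernel nu u * damped_sin nu (-2) (z * u `^ nu))).
  apply: (le_integrableR _ _ (integrable_parts_bound nuP)) => //; first exact: measurable_0y.
  move=> u; rewrite itv0yE => u0; rewrite normrM (le_trans _ (parts_kernel_le nuP u0))//.
  by rewrite ler_piMr// damped_sin_le1.
pose h u := mainardi_integrand nu z u + (z * nu) ^- 3 *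
     (parts_kernel nu u * damped_sin nu (-2) (z * u `^ nu)).
have H : \int[mu]_(u in `]0, +oo[) h u = 0.
  etransitivity.
    apply: (@FTC_oy _ 0 (parts_primitive nu z) h).
    - move=> u u0; apply: continuousD; first exact: cI.
      apply: continuousM; [exact: cst_continuous|exact: cK].
    - by move=> u u0; apply: is_derive_parts_primitive.
    - by apply: integrableDR => //; apply: integrableZlR.
    - exact: cvg_parts_primitive_0.
    - exact: cvg_parts_primitive_y.
  by rewrite subrr.
rewrite /h in H.
have -> : mainardi_int nu z = - ((z * nu) ^- 3 *
   \int[mu]_(u in `]0, +oo[) (parts_kernel nu u * damped_sin nu (-2) (z * u `^ nu))).
  apply/eqP; rewrite -addr_eq0 -RintegralZl// -RintegralD// ?H ?subrr//.
  by apply: integrableZlR.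
have zn : 0 <= (z * nu) ^- 3 by rewrite invr_ge0 exprn_ge0// mulr_ge0 ?ltW.
rewrite normrN normrM ger0_norm// mulrC ler_wpM2r//.
apply: (le_trans _ (integral_parts_bound_le nuP)).
apply: (le_trans (le_normr_Rintegral _ iK)) => //.
apply: le_Rintegral => //; first exact: integrable_norm.
- exact: integrable_parts_bound.
- move=> u; rewrite itv0yE => u0; rewrite normrM (le_trans _ (parts_kernel_le nuP u0))//.
  by rewrite ler_piMr// damped_sin_le1.
Qed.

End mainardi_decay.

(** * Continuity in the order, order one half, and iterated integrals *)

Section mainardi_half.
Context {R : realType}.
Local Notation mu := (@lebesgue_measure R).
Implicit Types (nu z u : R).

Lemma cvg_mainardi_integrand (nu z : nat -> R) nu0 z0 u : 0 < u ->
  nu n @[n --> \oo] --> nu0 -> z n @[n --> \oo] --> z0 ->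
  mainardi_integrand (nu n) (z n) u @[n --> \oo] --> mainardi_integrand nu0 z0 u.
Proof.
move=> u0 nul zl; rewrite /mainardi_integrand /damped_sin /powR (gt_eqF u0).
have L k : (expR ((nu n - k) * ln u)) @[n --> \oo] --> expR ((nu0 - k) * ln u).
  apply: continuous_cvg; first exact: continuous_expR.
  by apply: cvgMl; apply: cvgB => //; exact: cvg_cst.
have L0 : expR (nu n * ln u) @[n --> \oo] --> expR (nu0 * ln u).
  by have := L 0; under eq_fun do rewrite subr0; rewrite subr0.
have Lp : pi * nu n @[n --> \oo] --> pi * nu0 by exact: cvgMr.
have Ls : sin (pi * nu n) @[n --> \oo] --> sin (pi * nu0).
  by apply: continuous_cvg => //; exact: continuous_sin.
have Lc : cos (pi * nu n) @[n --> \oo] --> cos (pi * nu0).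
  by apply: continuous_cvg => //; exact: continuous_cos.
have E1 : expR (- (z n * expR (nu n * ln u) * cos (pi * nu n))) @[n --> \oo] -->
    expR (- (z0 * expR (nu0 * ln u) * cos (pi * nu0))).
  apply: continuous_cvg; first exact: continuous_expR.
  by apply: cvgN; apply: cvgM => //; exact: cvgM.
have E2 : sin (1 * (pi * nu n) - z n * expR (nu n * ln u) * sin (pi * nu n)) @[n --> \oo] -->
    sin (1 * (pi * nu0) - z0 * expR (nu0 * ln u) * sin (pi * nu0)).
  apply: continuous_cvg; first exact: continuous_sin.
  apply: cvgB; first exact: cvgMr.
  by apply: cvgM => //; exact: cvgM.
by apply: cvgM; [apply: cvgMl; exact: L|exact: cvgM].
Qed.

(** The bound of the damped sine by 1 does not involve z, so z may vary with n
   freely. *)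
Lemma cvg_mainardi_int (nu z : nat -> R) nu0 z0 : (forall n, 0 <= z n) ->
  (forall n, 1 / 4 <= nu n <= 1 / 2) -> nu n @[n --> \oo] --> nu0 ->
  z n @[n --> \oo] --> z0 ->
  mainardi_int (nu n) (z n) @[n --> \oo] --> mainardi_int nu0 z0.
Proof.
move=> zP nuP nul zl.
(* u^(nu-1) is at most u^(-3/4) for u <= 1 and at most 1 for u >= 1 *)
pose g u : R := u `^ (1 / 4 - 1) * expR (- u) + u `^ (1 - 1) * expR (- u).
have ig : mu.-integrable `]0, +oo[ (EFin \o g).
  by apply: integrableDR => //; apply: integrable_euler; lra.
apply: (@dominated_cvgR _ _ _ mu _ _ _ g _ _ _ ig _).2 => //.
- move=> n; apply: measurable_0y => u u0.
  have d0 := is_derive_damped_sin_powR (nu n) 1 (z n) u0.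
  by rewrite /mainardi_integrand; derive1_cont.
- move=> u; rewrite itv0yE => u0.
  exact: cvg_mainardi_integrand.
- move=> n u; rewrite itv0yE => u0; have /andP[n1 n2] := nuP n.
  rewrite normrM ger0_norm ?mulr_ge0 ?powR_ge0 ?expR_ge0//.
  apply: (@le_trans _ _ (u `^ (nu n - 1) * expR (- u))).
    rewrite ler_piMr ?mulr_ge0 ?powR_ge0 ?expR_ge0// damped_sin_le1//.
      by rewrite n2 andbT; lra.
    by rewrite mulr_ge0 ?powR_ge0.
  rewrite /g -mulrDl ler_wpM2r ?expR_ge0//.
  have [u1|/ltW u1] := leP u 1.
    by rewrite (@le_trans _ _ (u `^ (1 / 4 - 1))) ?lerDl ?powR_ge0// ger_powR ?u0//; lra.
  by rewrite (@le_trans _ _ (u `^ (1 - 1))) ?lerDr ?powR_ge0// ler_powR//; lra.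
Qed.

Lemma euler_integral_half : euler_integral (1 / 2 : R) = Num.sqrt pi.
Proof.
have H : 0 < (1 / 2 : R) < 1 by lra.
have := euler_reflection H.
rewrite (_ : 1 - 1 / 2 = 1 / 2 :> R); last by field.
rewrite mul1r sin_pihalf mulr1 -expr2 => <-.
by rewrite sqrtr_sqr ger0_norm// euler_integral_ge0.
Qed.

(** The duplication Gamma(j + 1/2) / (2j)! = sqrt(pi) / (4^j j!). *)
Lemma euler_integral_halfS (j : nat) :
  euler_integral (1 / 2 * j.*2.+1%:R) / j.*2`!%:R = Num.sqrt pi * (4^-1 ^+ j / j`!%:R) :> R.
Proof.
elim: j => [|j IH].
  rewrite [X in euler_integral X](_ : _ = 1 / 2) ?euler_integral_half; last exact: mulr1.
  by rewrite double0 fact0 expr0 !divr1 mulr1.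
rewrite doubleS (_ : 1 / 2 * j.*2.+3%:R = 1 / 2 * j.*2.+1%:R + 1); last first.
  by rewrite -!natr1; field.
rewrite euler_integralS ?mulr_gt0//.
have := IH; rewrite !factS !natrM exprS.
have -> : j.*2.+2%:R = 2 * j.+1%:R :> R by rewrite -natrM mul2n doubleS.
have j0 : j.+1%:R != 0 :> R by rewrite pnatr_eq0.
have j1 : j.*2.+1%:R != 0 :> R by rewrite pnatr_eq0.
have f0 : j`!%:R != 0 :> R by rewrite pnatr_eq0 -lt0n fact_gt0.
have f1 : j.*2`!%:R != 0 :> R by rewrite pnatr_eq0 -lt0n fact_gt0.
move: {IH} (euler_integral (1 / 2 * j.*2.+1%:R)) => E.
move: (j.+1%:R : R) (j.*2.+1%:R : R) (j`!%:R : R) (j.*2`!%:R : R)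
  (4^-1 ^+ j) (Num.sqrt pi) j0 j1 f0 f1 => J J2 F F2 Q P J0 J20 F0 F20 H.
have -> : E = P * (Q / F) * F2 by rewrite -H mulfVK.
by field; rewrite J0 F0 J20 F20.
Qed.

Lemma damped_coeff_half_odd (j : nat) : damped_coeff (1 / 2) j.*2.+1 = 0 :> R.
Proof.
rewrite /damped_coeff -doubleS (_ : _ * _ = pi * j.+1%:R); last first.
  by rewrite -muln2 natrM; field.
by rewrite sin_pi_nat mulr0.
Qed.

Lemma damped_coeff_half_even (j : nat) : damped_coeff (1 / 2) j.*2 = (-1) ^+ j :> R.
Proof.
rewrite /damped_coeff -mul2n exprM sqrrN !expr1n mul1r.
rewrite (_ : _ * _ = pi * j%:R + pi / 2); last first.
  by rewrite -natr1 natrM; field.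
rewrite sinDpihalf; elim: j => [|j IH]; first by rewrite mulr0 cos0.
by rewrite -natr1 mulrDr mulr1 cosDpi IH exprS mulN1r.
Qed.

(** At order 1/2 the odd coefficients are multiples of sin(pi n) = 0, and the
   even ones form the exponential series of - z^2 / 4. *)
Lemma mainardi_int_half z : 0 <= z ->
  mainardi_int (1 / 2) z = Num.sqrt pi * expR (- (z ^+ 2 / 4)).
Proof.
move=> z0; have H : 0 < (1 / 2 : R) <= 1 / 2 by lra.
have L := series_mainardi_cvg H z0.
have cd : n.*2 @[n --> \oo] --> \oo.
  apply/cvgnyPge => A; near=> n; rewrite (@leq_trans n)//; last by rewrite -addnn leq_addr.
  by near: n; exact: nbhs_infty_ge.
have {}L := cvg_comp _ _ cd L.
apply: (cvg_unique _ L) => //.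
(* along even lengths, since the partial sums of odd length repeat them *)
rewrite (_ : _ \o double =
    (fun n => Num.sqrt pi * series (exp_coeff (- (z ^+ 2 / 4))) n)); last first.
  apply/funext => n; elim: n => [|n IH].
    by rewrite /= /series/= big_ord0 big_geq// mulr0.
  rewrite /= doubleS !big_ord_recr/= damped_coeff_half_odd !mul0r addr0.
  move: IH => /= ->; rewrite /series/= big_nat_recr//= mulrDr; congr (_ + _).
  rewrite damped_coeff_half_even.
  transitivity ((-1) ^+ n * z ^+ n.*2 * (euler_integral (1 / 2 * n.*2.+1%:R) / n.*2`!%:R)).
    by ring.
  rewrite euler_integral_halfS -mul2n exprM /exp_coeff/= -[- (z ^+ 2 / 4)]mulN1r.
  rewrite (exprMn _ (-1)) (exprMn _ (z ^+ 2)).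
  by move: (n`!%:R^-1 : R) => F; ring.
apply: cvgMr; exact: is_cvg_series_exp_coeff.
Unshelve. all: by end_near. Qed.

Lemma mainardi_half z : 0 <= z ->
  mainardi_int (1 / 2) z / pi = expR (- (z ^+ 2 / 4)) / Num.sqrt pi.
Proof.
move=> z0; rewrite mainardi_int_half//.
have p0 : 0 < Num.sqrt pi :> R by rewrite sqrtr_gt0 pi_gt0.
rewrite -[pi in X in _ / X](@sqr_sqrtr R) ?pi_ge0//.
by move: (Num.sqrt pi) p0 (expR _) => p p0 E; field; rewrite gt_eqF.
Qed.

End mainardi_half.

Section iterated_integrals.
Context {R : realType}.
Local Notation mu := (@lebesgue_measure R).
Local Open Scope ereal_scope.

Section tensor.
Variables (A B : set R) (a b : R -> R).
Hypotheses (mA : measurable A) (mB : measurable B).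
Hypothesis ia : mu.-integrable A (EFin \o a).
Hypothesis ib : mu.-integrable B (EFin \o b).

Lemma integrable_tensor :
  (mu \x mu)%E.-integrable (A `*` B) (EFin \o (fun p => a p.1 * b p.2)%R).
Proof.
have ma : measurable_fun A a by apply/measurable_EFinP; case/integrableP : ia.
have mb : measurable_fun B b by apply/measurable_EFinP; case/integrableP : ib.
have mAB : measurable (A `*` B) by exact: measurableX.
have ma' : measurable_fun setT (a \_ A) by apply/(measurable_restrictT _ mA).
have mb' : measurable_fun setT (b \_ B) by apply/(measurable_restrictT _ mB).
have E : EFin \o (fun p => a p.1 * b p.2)%R \_ (A `*` B) =
   (fun p => ((a \_ A) p.1 * (b \_ B) p.2)%:E).
  apply/funext => -[x y] /=; congr EFin; rewrite !patchE in_setX/=.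
  by case: (x \in A); case: (y \in B); rewrite ?mulr0 ?mul0r.
refine ((integrable_mkcond _ _).2 _); first exact: measurableX.
rewrite restrict_EFin E.
have mab : measurable_fun setT (fun p : R * R => ((a \_ A) p.1 * (b \_ B) p.2)%:E).
  apply/measurable_EFinP; apply: measurable_funM.
  - exact: (measurableT_comp ma' measurable_fst).
  - exact: (measurableT_comp mb' measurable_snd).
apply/integrable12ltyP => //=.
under eq_integral => x _.
  under eq_integral => y _ do rewrite normrM EFinM.
  rewrite ge0_integralZl//; last first.
    apply/measurable_EFinP; exact: measurableT_comp.
  over.
rewrite ge0_integralZr//; last 2 first.
- apply/measurable_EFinP; exact: measurableT_comp.
- by apply: integral_ge0.
have fin (D : set R) (f : R -> R) : measurable D -> mu.-integrable D (EFin \o f) ->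
    \int[mu]_x `|(f \_ D) x|%:E < +oo.
  move=> mD iD; have/(integrable_mkcond _) := iD => /(_ mD).
  by rewrite restrict_EFin => /integrableP[].
have fa := fin _ _ mA ia; have fb := fin _ _ mB ib.
have ga : 0 <= \int[mu]_x `|(a \_ A) x|%:E by apply: integral_ge0.
have gb : 0 <= \int[mu]_x `|(b \_ B) x|%:E by apply: integral_ge0.
by rewrite lte_mul_pinfty// ge0_fin_numE.
Qed.

Variable f : R * R -> R.
Hypothesis mf : measurable_fun (A `*` B) f.
Hypothesis fab : forall x y, A x -> B y -> (`|f (x, y)| <= a x * b y)%R.

Lemma integrable_iterated : (mu \x mu)%E.-integrable (A `*` B) (EFin \o f).
Proof.
apply: (@le_integrableR _ _ _ (mu \x mu)%E (A `*` B) f (fun p => a p.1 * b p.2)%R).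
- exact: measurableX.
- exact: mf.
- exact: integrable_tensor.
by move=> [x y] [Ax By]; exact: fab.
Qed.

Let mpatch : measurable_fun setT (f \_ (A `*` B)).
Proof. by apply/(measurable_restrictT _ (measurableX mA mB)). Qed.

Let patch_in x y : A x -> (f \_ (A `*` B)) (x, y) = ((fun y => f (x, y)) \_ B) y.
Proof. by move=> Ax; rewrite !patchE in_setX/= mem_set. Qed.

Let patch_in2 x y : B y -> (f \_ (A `*` B)) (x, y) = ((fun x => f (x, y)) \_ A) x.
Proof. by move=> By; rewrite !patchE in_setX/= (mem_set By) andbT. Qed.

Lemma integrable_section1 x : A x -> mu.-integrable B (EFin \o (fun y => f (x, y))).
Proof.
move=> Ax; apply: (@le_integrableR _ _ _ mu B _ (fun y => a x * b y)%R) => //.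
- apply/(measurable_restrictT _ mB).
  rewrite (_ : _ \_ _ = fun y => (f \_ (A `*` B)) (x, y)); last first.
    by apply/funext => y; rewrite patch_in.
  exact: (measurableT_comp mpatch (pair1_measurable x)).
- exact: integrableZlR.
- by move=> y By; exact: fab.
Qed.

Lemma integrable_section2 y : B y -> mu.-integrable A (EFin \o (fun x => f (x, y))).
Proof.
move=> By; apply: (@le_integrableR _ _ _ mu A _ (fun x => b y * a x)%R) => //.
- apply/(measurable_restrictT _ mA).
  rewrite (_ : _ \_ _ = fun x => (f \_ (A `*` B)) (x, y)); last first.
    by apply/funext => x; rewrite patch_in2.
  exact: (measurableT_comp mpatch (pair2_measurable y)).
- exact: integrableZlR.
- by move=> x Ax; rewrite mulrC; exact: fab.
Qed.

Let ipatch : (mu \x mu)%E.-integrable setT (EFin \o (f \_ (A `*` B))).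
Proof.
rewrite -restrict_EFin; refine ((integrable_mkcond _ _).1 _).
  exact: measurableX.
exact: integrable_iterated.
Qed.

(** Iterated real integrals over a rectangle equal the double one; outside the
   rectangle the integrand is extended by 0 so that Fubini's theorem on the
   whole plane applies. *)
Lemma Rintegral_iterated12 :
  (\int[mu]_(x in A) \int[mu]_(y in B) f (x, y) = \int[(mu \x mu)%E]_(p in A `*` B) f p)%R.
Proof.
rewrite [RHS]Rintegral_mkcond /Rintegral -(integral12_prod_meas1 ipatch); congr fine.
rewrite [LHS]integral_mkcond; apply: eq_integral => x _; rewrite patchE /fubini_F.
case: ifPn => [/set_mem Ax|nAx].
  rewrite fineK; last exact: integrable_fin_num (integrable_section1 Ax).
  rewrite integral_mkcond; apply: eq_integral => y _ /=.
  by rewrite patch_in// !patchE; case: ifP.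
rewrite [RHS]integral0_eq// => y _ /=.
by rewrite patchE in_setX/= (negbTE nAx).
Qed.

Lemma Rintegral_iterated21 :
  (\int[mu]_(y in B) \int[mu]_(x in A) f (x, y) = \int[(mu \x mu)%E]_(p in A `*` B) f p)%R.
Proof.
rewrite [RHS]Rintegral_mkcond /Rintegral -(integral21_prod_meas1 ipatch); congr fine.
rewrite [LHS]integral_mkcond; apply: eq_integral => y _; rewrite patchE /fubini_G.
case: ifPn => [/set_mem By|nBy].
  rewrite fineK; last exact: integrable_fin_num (integrable_section2 By).
  rewrite integral_mkcond; apply: eq_integral => x _ /=.
  by rewrite patch_in2// !patchE; case: ifP.
rewrite [RHS]integral0_eq// => x _ /=.
by rewrite patchE in_setX/= (negbTE nBy) andbF.
Qed.

End tensor.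

(** The dominating function is a product, so Fubini's theorem applies to every
   term and to the limit, where the order of integration is exchanged. *)
Lemma dominated_cvg_iterated (A B : set R) (a b : R -> R)
    (f_ : nat -> R * R -> R) (f : R * R -> R) :
  measurable A -> measurable B ->
  mu.-integrable A (EFin \o a) -> mu.-integrable B (EFin \o b) ->
  (forall n, measurable_fun (A `*` B) (f_ n)) ->
  (forall n x y, A x -> B y -> `|f_ n (x, y)| <= a x * b y)%R ->
  (forall x y, A x -> B y -> f_ n (x, y) @[n --> \oo] --> f (x, y)) ->
  (\int[mu]_(x in A) \int[mu]_(y in B) f_ n (x, y))%R @[n --> \oo] -->
  (\int[mu]_(y in B) \int[mu]_(x in A) f (x, y))%R.
Proof.
move=> mA mB ia ib mf fab ff.
have mAB : measurable (A `*` B) by exact: measurableX.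
have mflim : measurable_fun (A `*` B) f.
  by apply: (measurable_fun_cvg mf) => -[x y] [Ax By]; exact: ff.
have flim x y : A x -> B y -> (`|f (x, y)| <= a x * b y)%R.
  move=> Ax By; apply: (cvgr_to_le (cvg_norm (ff x y Ax By))).
  by apply: nearW => n; exact: fab.
rewrite (Rintegral_iterated21 mA mB ia ib mflim flim).
under eq_fun => n do rewrite (Rintegral_iterated12 mA mB ia ib (mf n) (fab n)).
have [] // := @dominated_cvgR _ _ _ (mu \x mu)%E (A `*` B) f_ f (fun p => a p.1 * b p.2)%R.
- by move=> [x y] [Ax By]; exact: ff.
- exact: integrable_tensor.
- by move=> n [x y] [Ax By]; exact: fab.
Qed.

End iterated_integrals.

(** * Boundary data and the heat kernel *)

Section boundary_data.
Context {R : realType}.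
Local Notation mu := (@lebesgue_measure R).
Variables (T : R) (g : R -> R).
Hypothesis g_cont : {within `[0, T[, continuous g}.

Let cont_sub (b : R) : b < T -> {within `[0, b], continuous g}.
Proof.
move=> bT; apply: continuous_subspaceW g_cont => x /=; rewrite !in_itv/= => /andP[-> xb].
exact: le_lt_trans bT.
Qed.

Lemma continuous_segment_bounded (b : R) : b < T ->
  exists2 K : R, 0 < K & forall x : R, 0 <= x <= b -> `|g x| <= K.
Proof.
move=> /cont_sub cg.
have /compact_bounded[M [Mr HM]] := continuous_compact cg (segment_compact (a := 0) (b := b)).
exists (`|M| + 1); first by rewrite ltr_wpDl.
move=> x xb; apply: (HM (`|M| + 1)).
  by rewrite (le_lt_trans (ler_norm _))// ltrDl.
by exists x => //=; rewrite in_itv.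
Qed.

Lemma measurable_boundary_data (b : R) (D : set R) : b < T -> measurable D ->
  (forall x : R, D x -> 0 <= x <= b) -> measurable_fun D g.
Proof.
move=> bT mD Db; apply: (@measurable_funS _ _ _ _ (`[0, b]%classic : set R)) => //.
by apply: subspace_continuous_measurable_fun => //; exact: cont_sub.
Qed.

Lemma continuous_interior (x : R) : 0 < x < T -> {for x, continuous g}.
Proof.
move=> xT; have := g_cont.
move/(continuous_subspaceW (@subset_itv_oo_co _ _ 0 T)).
rewrite continuous_open_subspace//.
by apply; rewrite inE/= in_itv.
Qed.

End boundary_data.

Section heat_kernel.
Context {R : realType}.
Local Notation mu := (@lebesgue_measure R).
Variable lambda : R.
Hypothesis l0 : 0 < lambda.
Implicit Types x s u v : R.
Let k : R := (4 * lambda ^+ 2)^-1.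

Let k0 : 0 < k. Proof. by rewrite invr_gt0 mulr_gt0 ?exprn_gt0. Qed.

(** Up to the factor - lambda, the response at x to a unit flux at time 0. For
   s <= 0 the square root is 0, hence so is the quotient: the kernel is causal
   without any case distinction. *)
Definition heat_kernel x s : R :=
  expR (- (x ^+ 2 / (4 * lambda ^+ 2 * s))) / Num.sqrt (pi * s).

Definition heat_kernel_x x s : R := - (2 * k * x * s^-1) * heat_kernel x s.

Definition heat_kernel_xx x s : R :=
  ((2 * k * x * s^-1) ^+ 2 - 2 * k * s^-1) * heat_kernel x s.

Definition heat_kernel_s x s : R :=
  (k * (x * s^-1) ^+ 2 - 2^-1 * s^-1) * heat_kernel x s.

Lemma heat_kernel_heat x s : heat_kernel_s x s = lambda ^+ 2 * heat_kernel_xx x s.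
Proof.
rewrite /heat_kernel_s /heat_kernel_xx mulrA /k; congr (_ * heat_kernel x s).
by move: s^-1 => p; field; rewrite gt_eqF.
Qed.

Lemma heat_kernel_le0 x s : s <= 0 -> heat_kernel x s = 0.
Proof.
by move=> s0; rewrite /heat_kernel ler0_sqrtr ?invr0 ?mulr0// pmulr_rle0 ?pi_gt0.
Qed.

Lemma heat_kernelE x s : 0 < s -> heat_kernel x s =
  expR (- (k * x ^+ 2 * s `^ (- 1))) * s `^ (- (1 / 2)) / Num.sqrt pi.
Proof.
move=> s0; have E : x ^+ 2 / (4 * lambda ^+ 2 * s) = k * x ^+ 2 * s `^ (- 1).
  by rewrite powR_inv1 ?ltW// invfM -/k; ring.
rewrite /heat_kernel E sqrtrM ?pi_ge0// invfM -(powR12_sqrt (ltW s0)) -[(s `^ _)^-1]powRN.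
by rewrite (_ : 1 / 2 = 2^-1 :> R); [ring|field].
Qed.

Lemma is_derive_heat_kernel_x x s :
  is_derive x 1 (heat_kernel ^~ s) (heat_kernel_x x s).
Proof.
rewrite /heat_kernel_x /heat_kernel; derive1_to.
by rewrite /= invfM -/k; ring.
Qed.

Lemma is_derive_heat_kernel_xx x s :
  is_derive x 1 (heat_kernel_x ^~ s) (heat_kernel_xx x s).
Proof.
have d := is_derive_heat_kernel_x x s.
rewrite /heat_kernel_x; derive1_to.
by rewrite /heat_kernel_x /heat_kernel_xx /=; ring.
Qed.

Lemma heat_kernel_ge0 x s : 0 <= heat_kernel x s.
Proof. by rewrite divr_ge0 ?expR_ge0 ?sqrtr_ge0. Qed.

(** With p = 1/s the kernel is at most (1 + p) e^(- k u^2 p), k = 1 / (4 lambda^2),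
   and the exponential dominates any power of 1 + p. *)
Lemma heat_kernel_decay u : 0 < u -> exists2 C, 0 < C &
  forall x s, u <= x -> (1 + s^-1) ^+ 2 * heat_kernel x s <= C.
Proof.
move=> u0; have c0 : 0 < k * u ^+ 2 by rewrite mulr_gt0 ?exprn_gt0.
have [C C0 HC] := powR_expR_bounded 3 c0.
exists C => // x s ux; have [s0|s0] := leP s 0.
  by rewrite heat_kernel_le0// mulr0 ltW.
have p0 : 0 < s^-1 by rewrite invr_gt0.
have q0 : 1 <= Num.sqrt pi :> R.
  by rewrite -sqrtr1 ler_sqrt ?pi_gt0// (le_trans _ (pi_ge2 R))// ler1n.
have H : heat_kernel x s <= (1 + s^-1) * expR (- (k * u ^+ 2 * s^-1)).
  rewrite heat_kernelE// powR_inv1; last exact: ltW.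
  rewrite ler_pdivrMr; last exact: lt_le_trans q0.
  apply: (@le_trans _ _ ((1 + s^-1) * expR (- (k * u ^+ 2 * s^-1)))).
    rewrite [leRHS]mulrC; apply: ler_pM; rewrite ?expR_ge0 ?powR_ge0//.
      rewrite ler_expR lerN2 ler_wpM2r//; first exact: ltW.
      rewrite ler_wpM2l//; first exact: ltW.
      by rewrite lerXn2r ?nnegrE// ltW// (lt_le_trans u0).
    have [s1|/ltW s1] := leP s 1.
      rewrite ler_wpDl// -[s^-1]powR_inv1; last exact: ltW.
      by rewrite ger_powR ?s0//; lra.
    rewrite ler_wpDr//; first exact: ltW.
    by rewrite -[leRHS](powRr0 s) ler_powR//; lra.
  rewrite ler_peMr// mulr_ge0 ?expR_ge0//; lra.
apply: le_trans (HC _ (ltW p0)).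
rewrite powR_mulrn; last lra.
rewrite (exprSr _ 2) -mulrA ler_wpM2l// sqr_ge0//.
Qed.

(** Each derivative is the kernel times a polynomial of degree at most 2 in 1/s
   with coefficients bounded in terms of x <= v, so [heat_kernel_decay] absorbs
   it. *)
Lemma heat_kernel_derivs_bounded u v : 0 < u -> exists2 C, 0 < C &
  forall x s, u <= x <= v ->
  [/\ `|heat_kernel x s| <= C, `|heat_kernel_x x s| <= C,
      `|heat_kernel_xx x s| <= C & `|heat_kernel_s x s| <= C].
Proof.
move=> u0; have [C C0 HC] := heat_kernel_decay u0.
(* the sum of all coefficients that occur, so as to serve the four bounds *)
pose L := 1 + 2 * k * `|v| + ((2 * k * `|v|) ^+ 2 + 2 * k) + (k * `|v| ^+ 2 + 2^-1).
have kv0 : 0 <= k * `|v| by rewrite mulr_ge0// ltW.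
have kv20 : 0 <= k * `|v| ^+ 2 by rewrite mulr_ge0 ?sqr_ge0// ltW.
have kk0 := k0.
have kv2 : 0 <= (2 * k * `|v|) ^+ 2 by exact: sqr_ge0.
have L1 : 1 <= L by rewrite /L; lra.
exists (L * C) => [|x s /andP[ux xv]]; first by rewrite mulr_gt0// (lt_le_trans ltr01).
have [s0|s0] := leP s 0.
  rewrite /heat_kernel_x /heat_kernel_xx /heat_kernel_s heat_kernel_le0// !mulr0 normr0.
  by have : 0 <= L * C by rewrite mulr_ge0// ltW// (lt_le_trans ltr01).
have p0 : 0 < s^-1 by rewrite invr_gt0.
have x0 : 0 < x by rewrite (lt_le_trans u0).
have xv' : x <= `|v| by rewrite (le_trans xv)// ler_norm.
have H q : `|q| <= L * (1 + s^-1) ^+ 2 -> `|q * heat_kernel x s| <= L * C.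
  move=> Hq; rewrite normrM [X in _ * X]ger0_norm ?heat_kernel_ge0//.
  apply: (@le_trans _ _ (L * (1 + s^-1) ^+ 2 * heat_kernel x s)).
    by rewrite ler_wpM2r ?heat_kernel_ge0.
  by rewrite -mulrA ler_wpM2l ?HC// (le_trans ler01).
have key (a b : R) : 0 <= a -> 0 <= b -> a + b <= L ->
    `|a * s^-1 ^+ 2 - b * s^-1| <= L * (1 + s^-1) ^+ 2.
  move: {H} (s^-1) p0 (L) L1 => p p0 {}L L1 a0 b0 abL.
  have pp : 0 <= p ^+ 2 by exact: sqr_ge0.
  have ap : 0 <= a * p ^+ 2 by rewrite mulr_ge0.
  have bp : 0 <= b * p by rewrite mulr_ge0// ltW.
  have : (a + b) * (1 + p) ^+ 2 <= L * (1 + p) ^+ 2 by rewrite ler_wpM2r ?sqr_ge0.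
  have : 0 <= a * p by rewrite mulr_ge0// ltW.
  have : 0 <= b * p ^+ 2 by rewrite mulr_ge0.
  by rewrite ler_norml sqrrD expr1n; lra.
have kx0 : 0 <= k * x by rewrite mulr_ge0// ltW.
have kxv : k * x <= k * `|v| by rewrite ler_wpM2l// ltW.
have kxv2 : k * x ^+ 2 <= k * `|v| ^+ 2.
  by rewrite ler_wpM2l ?lerXn2r ?nnegrE// ltW.
have kx2 : 0 <= k * x ^+ 2 by rewrite mulr_ge0 ?sqr_ge0// ltW.
have kkv2 : (2 * k * x) ^+ 2 <= (2 * k * `|v|) ^+ 2.
  by rewrite lerXn2r ?nnegrE//; lra.
have kk2 : 0 <= (2 * k * x) ^+ 2 by exact: sqr_ge0.
rewrite /heat_kernel_x /heat_kernel_xx /heat_kernel_s.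
split.
- rewrite -[heat_kernel x s]mul1r; apply: H; rewrite normr1 -[leLHS]mulr1.
  apply: ler_pM => //; rewrite expr_ge1//; lra.
- apply: H; rewrite (_ : - _ = 0 * s^-1 ^+ 2 - 2 * k * x * s^-1); last by ring.
  by apply: key; rewrite ?lexx// -?mulrA ?mulr_ge0// /L -?mulrA; lra.
- apply: H; rewrite exprMn.
  apply: key => //; first by rewrite mulr_ge0// ltW.
  by rewrite /L; lra.
- apply: H; rewrite exprMn mulrA.
  by apply: key => //; rewrite /L; lra.
Qed.

Lemma is_derive0_quadratic (f : R -> R) (C : R) : 
  (forall s, `|f s| <= C * s ^+ 2) -> is_derive (0 : R) 1 f 0.
Proof.
move=> fC; have C0 : 0 <= C.
  by have := fC 1; rewrite expr1n mulr1; apply: le_trans.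
have f0 : f 0 = 0.
  by apply/eqP; rewrite -normr_le0 (le_trans (fC 0))// expr0n mulr0.
suff L : h^-1 *: ((f \o shift 0) (h *: 1) - f 0) @[h --> 0^'] --> (0 : R).
  by apply: DeriveDef; [apply/cvg_ex; exists 0|exact: cvg_lim].
apply/cvgrPdist_le => e e0; near=> h.
have h0 : h != 0 by near: h; exact: nbhs_dnbhs_neq.
have he : `|h| <= e / (C + 1).
  by near: h; apply: dnbhs0_le; rewrite divr_gt0// ltr_wpDl.
rewrite sub0r normrN /= f0 subr0 addr0 [h *: 1]mulr1 normrM normfV.
rewrite mulrC ler_pdivrMr ?normr_gt0// (le_trans (fC h))//.
rewrite -real_normK ?num_real// expr2 mulrA ler_wpM2r//.
rewrite (@le_trans _ _ (C * (e / (C + 1))))// ?ler_wpM2l//.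
rewrite mulrCA ger_pMr// ler_pdivrMr ?mul1r ?lerDl// ltr_wpDl//.
Unshelve. all: by end_near. Qed.

(** The kernel vanishes for s <= 0 and is O(s^2) for s > 0, so the two pieces fit
   together at s = 0. *)
Lemma is_derive_heat_kernel_s x s : 0 < x ->
  is_derive s 1 (heat_kernel x) (heat_kernel_s x s).
Proof.
move=> x0; have [s0|s0|->] := ltgtP s 0.
- apply: (@near_eq_is_derive _ _ _ (cst 0)).
    near=> y; rewrite heat_kernel_le0// ltW//.
    by near: y; exact: lt_nbhsl.
  by rewrite /heat_kernel_s heat_kernel_le0 ?ltW// mulr0; exact: is_derive_cst.
- have d : is_derive s 1 (fun s => expR (- (k * x ^+ 2 * s `^ (- 1))) * s `^ (- (1 / 2)) / Num.sqrt pi)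
      (heat_kernel_s x s).
    rewrite /heat_kernel_s (heat_kernelE x s0); derive1_to.
    rewrite /= !powR_add// powR_inv1 ?ltW//.
    move: (s `^ _) (expR _) (Num.sqrt pi)^-1 => P E Q.
    by move: (s^-1) => p; field.
  apply: (near_eq_is_derive _ d).
  near=> y; rewrite heat_kernelE//.
  by near: y; exact: lt_nbhsr.
- have [C C0 HC] := heat_kernel_decay x0.
  rewrite /heat_kernel_s (heat_kernel_le0 x (lexx 0)) mulr0; apply: (@is_derive0_quadratic _ C) => {}s.
  have [s0|s0] := leP s 0.
    by rewrite heat_kernel_le0// normr0 mulr_ge0 ?sqr_ge0// ltW.
  rewrite ger0_norm ?heat_kernel_ge0// -ler_pdivrMr ?exprn_gt0// mulrC.
  apply: le_trans (HC x s _) => //; rewrite ler_wpM2r ?heat_kernel_ge0//.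
  by rewrite -exprVn lerXn2r ?nnegrE ?lerDr// ?addr_ge0// ltW// invr_gt0.
Unshelve. all: by end_near. Qed.

End heat_kernel.

Section convolution.
Context {R : realType}.
Local Notation mu := (@lebesgue_measure R).

Lemma integrable_cst_oo (a b c : R) :
  mu.-integrable (`]a, b[%classic : set R) (EFin \o (fun=> c)).
Proof.
apply: (@integrableS _ _ _ mu (`[a, b]%classic : set R)).
- exact: measurable_itv.
- exact: measurable_itv.
- exact: subset_itv_oo_cc.
- by apply: integrable_segment => x _; exact: cst_continuous.
Qed.

(** As tau runs over ]0, b[ the argument t - tau runs over ]t - b, t[, which is
   where phi is asked to be continuous: b = t needs only positive arguments,
   b > t also negative ones. *)
Lemma integrable_convolution (T : R) (g phi : R -> R) (C t b : R) :
  {within `[0, T[, continuous g} -> b < T ->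
  (forall s : R, t - b < s < t -> {for s, continuous phi}) ->
  (forall s : R, `|phi s| <= C) ->
  mu.-integrable `]0, b[ (EFin \o (fun tau => phi (t - tau) * g tau)).
Proof.
move=> gc bT cphi phiC; have /(_ b bT)[K K0 gK] := continuous_segment_bounded gc.
apply: (@le_integrableR _ _ _ mu (`]0, b[%classic : set R) _ (fun=> C * K)).
- exact: measurable_itv.
- apply: measurable_funM; last first.
    apply: (measurable_boundary_data gc bT); first exact: measurable_itv.
    by move=> tau; rewrite /= in_itv/= => /andP[/ltW -> /ltW ->].
  apply: open_continuous_measurable_fun; first exact: itv_open.
  move=> tau /set_mem; rewrite /= in_itv/= => tauB.
  apply: (@continuous_comp _ _ _ (fun tau => t - tau) phi).
    by apply: continuousB; [exact: cst_continuous|exact: id].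
  by apply: cphi; lra.
- exact: integrable_cst_oo.
- move=> tau; rewrite /= in_itv/= => tauB; rewrite normrM.
  by apply: ler_pM => //; apply: gK; lra.
Qed.

End convolution.

(** * The limit of the fractional solutions *)

Section fractional_limit.
Context {R : realType}.
Local Notation mu := (@lebesgue_measure R).
Variables (lambda x t : R).
Hypotheses (l0 : 0 < lambda) (x0 : 0 < x) (t0 : 0 < t).
Implicit Types (nu s xi tau : R).

(** The integrand of c5 without g, as a function of the elapsed time s = t - tau. *)
Definition flux_kernel nu xi s : R :=
  mainardi nu (xi / (lambda * s `^ nu)) * (xi / (lambda * s `^ (nu + 1))) * nu.

(** The kernel is M_nu(z) z nu / s with z = xi / (lambda s^nu), so the cubic decay
   leaves (z nu)^-2 / s, that is xi^-2 s^(2 nu - 1) up to a constant, and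
   -1/2 <= 2 nu - 1 < 0. *)
Lemma flux_kernel_bound nu xi s : 1 / 4 <= nu < 1 / 2 -> 0 < xi -> 0 < s ->
  `|flux_kernel nu xi s| <= xi ^- 2 * (192 * lambda ^+ 2 * (1 + s `^ (- (1 / 2)))).
Proof.
move=> /andP[n1 n2] xi0 s0; have nu0 : 0 < nu by lra.
have p0 : 0 < s `^ nu by rewrite powR_gt0.
pose z := xi / (lambda * s `^ nu).
have z0 : 0 < z by rewrite divr_gt0// mulr_gt0.
have zn0 : 0 < z * nu by rewrite mulr_gt0.
have pi1 : 1 <= pi :> R by rewrite (le_trans _ (pi_ge2 R))// ler1n.
have M : `|mainardi nu z| <= 12 / (z * nu) ^+ 3.
  rewrite mainardiE; [|lra|exact: ltW].
  rewrite normrM [`|pi^-1|]ger0_norm; last by rewrite invr_ge0 pi_ge0.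
  rewrite (@le_trans _ _ (`|mainardi_int nu z|))//.
    by rewrite ler_piMr// invf_le1// (lt_le_trans ltr01).
  by apply: mainardi_int_decay => //; lra.
have -> : flux_kernel nu xi s = mainardi nu z * (z * nu / s).
  rewrite /flux_kernel -/z powR_add// powRr1 ?ltW// /z.
  by move: (s `^ nu) p0 => P P0; field; rewrite ?gt_eqF.
rewrite normrM [X in _ * X]ger0_norm; last by rewrite divr_ge0// ltW.
apply: (@le_trans _ _ (12 / (z * nu) ^+ 3 * (z * nu / s))).
  by rewrite ler_wpM2r// divr_ge0 ?ltW.
have -> : 12 / (z * nu) ^+ 3 * (z * nu / s) =
    xi ^- 2 * (12 * nu ^- 2 * lambda ^+ 2 * (s `^ nu * s `^ nu / s)).
  rewrite /z; move: (s `^ nu) p0 => P P0.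
  by field; rewrite ?gt_eqF.
rewrite ler_wpM2l ?invr_ge0 ?sqr_ge0//.
apply: ler_pM.
- by rewrite mulr_ge0 ?sqr_ge0// mulr_ge0// invr_ge0 sqr_ge0.
- by rewrite divr_ge0 ?mulr_ge0 ?ltW.
- rewrite ler_wpM2r ?sqr_ge0// (_ : 192 = 12 * 16 :> R); last by ring.
  rewrite ler_wpM2l// -[16]invrK lef_pV2 ?posrE ?invr_gt0// ?exprn_gt0//.
  by rewrite (_ : 16^-1 = (1 / 4) ^+ 2 :> R); [rewrite lerXn2r ?nnegrE//; lra|field].
- have -> : s `^ nu * s `^ nu / s = s `^ (nu + nu - 1).
    by rewrite !powR_add// powRN powRr1// ltW.
  have [s1|/ltW s1] := leP s 1.
    by rewrite ler_wpDl// ger_powR ?s0//; lra.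
  rewrite (@le_trans _ _ 1) ?lerDl ?powR_ge0//.
  by rewrite -[leRHS](powRr0 s) ler_powR//; lra.
Qed.

(** Measurability of M_nu along a measurable function comes from its being a
   pointwise limit of polynomials. *)
Lemma measurable_flux_kernel nu : 0 < nu <= 1 / 2 ->
  measurable_fun (`]x, +oo[%classic `*` `]0, t[%classic)
    (fun p : R * R => flux_kernel nu p.1 (t - p.2)).
Proof.
move=> nuP; set D := (X in measurable_fun X).
have mpow r : measurable_fun D (fun p : R * R => (t - p.2) `^ r).
  apply: (measurableT_comp (measurable_powR r)).
  apply: measurable_funB => //; apply: measurable_funTS; exact: measurable_snd.
have m1 : measurable_fun D (fun p : R * R => p.1) by apply: measurable_funTS; exact: measurable_fst.
have DP p : D p -> 0 < p.1 /\ 0 < t - p.2.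
  case: p => xi tau [] /=; rewrite !in_itv/= andbT => xxi /andP[tau0 taut].
  by rewrite (lt_trans x0)//; split => //; rewrite subr_gt0.
pose z (p : R * R) := p.1 * (lambda^-1 * (t - p.2) `^ (- nu)).
have mz : measurable_fun D z.
  by apply: measurable_funM => //; exact: measurable_funM.
have zE p : D p -> p.1 / (lambda * (t - p.2) `^ nu) = z p.
  by move=> _; rewrite invfM /z powRN.
have z0 p : D p -> 0 <= z p.
  by move=> /DP[p1 p2]; rewrite mulr_ge0 ?ltW// mulr_gt0 ?invr_gt0 ?powR_gt0.
apply: measurable_funM => //; apply: measurable_funM.
  apply: (@eq_measurable_fun _ _ _ _ _ (fun p => mainardi_int nu (z p) / pi)).
    by move=> p /set_mem Dp; rewrite zE// mainardiE// z0.
  apply: measurable_funM => //.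
  apply: (@measurable_fun_cvg _ _ _ _ (fun n p => \sum_(i < n)
    damped_coeff nu i * (z p ^+ i / i`!%:R) * euler_integral (nu * i.+1%:R))).
    move=> n; apply: measurable_sum => i; apply: measurable_funM => //.
    apply: measurable_funM => //; apply: measurable_funM => //.
    exact: measurable_funX.
  by move=> p Dp; apply: series_mainardi_cvg => //; exact: z0.
apply: (@eq_measurable_fun _ _ _ _ _ (fun p : R * R => p.1 * (lambda^-1 * (t - p.2) `^ (- (nu + 1))))).
  by move=> p /set_mem Dp; rewrite invfM powRN.
by apply: measurable_funM => //; exact: measurable_funM.
Qed.

Lemma cvg_flux_kernel (nu : nat -> R) xi s : 0 < xi -> 0 < s ->
  (forall n, 1 / 4 <= nu n < 1 / 2) -> nu n @[n --> \oo] --> (1 / 2 : R) ->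
  flux_kernel (nu n) xi s @[n --> \oo] -->
  xi / (2 * lambda * Num.sqrt pi * s `^ (3 / 2)) * expR (- (xi ^+ 2 / (4 * lambda ^+ 2 * s))).
Proof.
move=> xi0 s0 nuP nul.
have pc r : s `^ (nu n + r) @[n --> \oo] --> s `^ (1 / 2 + r).
  rewrite /powR (gt_eqF s0); apply: continuous_cvg; first exact: continuous_expR.
  by apply: cvgMl; apply: cvgD => //; exact: cvg_cst.
have pc0 : s `^ nu n @[n --> \oo] --> s `^ (1 / 2).
  by have := pc 0; under eq_fun do rewrite addr0; rewrite addr0.
have p0 r : s `^ r != 0 by rewrite gt_eqF// powR_gt0.
have dc r : xi / (lambda * s `^ (nu n + r)) @[n --> \oo] --> xi / (lambda * s `^ (1 / 2 + r)).
  apply: cvgMr; apply: cvgV; first by rewrite mulf_neq0 ?gt_eqF// powR_gt0.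
  exact: cvgMr.
have dc0 : xi / (lambda * s `^ nu n) @[n --> \oo] --> xi / (lambda * s `^ (1 / 2)).
  by have := dc 0; under eq_fun do rewrite addr0; rewrite addr0.
have z0 n : 0 <= xi / (lambda * s `^ nu n).
  by rewrite ltW// divr_gt0// mulr_gt0// powR_gt0.
have L : mainardi (nu n) (xi / (lambda * s `^ nu n)) * (xi / (lambda * s `^ (nu n + 1))) * nu n
    @[n --> \oo] --> mainardi_int (1 / 2) (xi / (lambda * s `^ (1 / 2))) / pi *
      (xi / (lambda * s `^ (1 / 2 + 1))) * (1 / 2).
  apply: cvgM => //; apply: cvgM => //.
  rewrite (_ : (fun n => _) = fun n => mainardi_int (nu n) (xi / (lambda * s `^ nu n)) / pi).
    apply: cvgMl; apply: cvg_mainardi_int => // n.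
    by have /andP[-> /ltW] := nuP n.
  by apply/funext => n; rewrite mainardiE//; have := nuP n; lra.
rewrite (_ : _ * expR _ = mainardi_int (1 / 2) (xi / (lambda * s `^ (1 / 2))) / pi *
      (xi / (lambda * s `^ (1 / 2 + 1))) * (1 / 2))//.
rewrite mainardi_half; last by rewrite ltW// divr_gt0// mulr_gt0// powR_gt0.
have -> : (xi / (lambda * s `^ (1 / 2))) ^+ 2 / 4 = xi ^+ 2 / (4 * lambda ^+ 2 * s).
  have sE : s = s `^ (1 / 2) * s `^ (1 / 2).
    by rewrite -powR_add// (_ : 1 / 2 + 1 / 2 = 1 :> R) ?powRr1 ?ltW//; field.
  rewrite [in RHS]sE; move: (s `^ _) (p0 (1 / 2)) => P P0; field.
  by rewrite P0 gt_eqF.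
have -> : (1 / 2 + 1 = 3 / 2 :> R) by field.
have q0 : Num.sqrt pi != 0 :> R by rewrite gt_eqF// sqrtr_gt0 pi_gt0.
move: (s `^ _) (p0 (3 / 2)) (Num.sqrt pi) q0 (expR _) => P P0 Q Q0 E.
by field; rewrite Q0 P0 gt_eqF.
Qed.

(** The integrand is the xi-derivative of a multiple of e^(-xi^2/(4 lambda^2 s)). *)
Lemma integral_gauss_flux s : 0 < s ->
  let f xi := xi / (2 * lambda * Num.sqrt pi * s `^ (3 / 2)) *
     expR (- (xi ^+ 2 / (4 * lambda ^+ 2 * s))) in
  mu.-integrable (`]x, +oo[%classic : set R) (EFin \o f) /\
  \int[mu]_(xi in `]x, +oo[) f xi =
  lambda * (expR (- (x ^+ 2 / (4 * lambda ^+ 2 * s))) / Num.sqrt (pi * s)).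
Proof.
move=> s0 f; have q0 : 0 < Num.sqrt pi :> R by rewrite sqrtr_gt0 pi_gt0.
have r0 : 0 < s `^ (3 / 2) by rewrite powR_gt0.
have c0 : 0 < 4 * lambda ^+ 2 * s by rewrite !mulr_gt0.
pose k := (4 * lambda ^+ 2 * s)^-1.
have k0 : 0 < k by rewrite invr_gt0.
pose A := (4 * lambda * k * Num.sqrt pi * s `^ (3 / 2))^-1.
have A0 : 0 < A by rewrite invr_gt0 !mulr_gt0.
pose G (xi : R) := - A * expR (- (xi ^+ 2 * k)).
have E : f = fun xi => A * (2 * xi * k) * expR (- (xi ^+ 2 * k)).
  apply/funext => xi; rewrite /f -/k; congr (_ * _); rewrite /A.
  clear A A0 G.
  move: (s `^ _) r0 k k0 (Num.sqrt pi) q0 => S S0 k k0 Q Q0.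
  by field; rewrite ?gt_eqF.
have dG xi : is_derive xi 1 G (A * (2 * xi * k) * expR (- (xi ^+ 2 * k))).
  by rewrite /G; derive1_to; rewrite /=; ring.
have ch xi : {for xi, continuous (fun xi => A * (2 * xi * k) * expR (- (xi ^+ 2 * k)))}.
  by derive1_cont.
have ih : mu.-integrable (`]x, +oo[%classic : set R)
    (EFin \o (fun xi => A * (2 * xi * k) * expR (- (xi ^+ 2 * k)))).
  apply: (@integrable_oy _ x G _ _ _ A).
  - by move=> xi _; exact: ch.
  - move=> xi xxi; have xi0 := lt_trans x0 xxi.
    by rewrite !mulr_ge0 ?expR_ge0 ?ltW.
  - move=> xi _; rewrite /G normrM normrN (ger0_norm (ltW A0)) (ger0_norm (expR_ge0 _)).
    rewrite ler_piMr//; first exact: ltW.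
    by rewrite -[leRHS]expR0 ler_expR oppr_le0 mulr_ge0 ?sqr_ge0 ?ltW.
rewrite E; split => //; rewrite (@FTC_oy _ x G _ _ _ (G x) 0).
- rewrite sub0r /G mulNr opprK -/k [RHS]mulrCA mulrC; congr (_ * _).
  rewrite sqrtrM ?pi_ge0// /A /k.
  have -> : 3 / 2 = 1 / 2 + 1 :> R by field.
  rewrite powR_add// powRr1 ?ltW// -(powR12_sqrt (ltW s0)).
  rewrite (_ : 1 / 2 = 2^-1 :> R); last by field.
  have P0 : 0 < s `^ 2^-1 by rewrite powR_gt0.
  move: (s `^ _) P0 (Num.sqrt pi) q0 => P P0 Q Q0.
  by field; rewrite ?gt_eqF.
- by move=> xi _; exact: ch.
- exact: ih.
- apply: cvg_at_right_filter.
  exact: (is_derive1_continuous (dG x)).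
- rewrite [X in _ --> X](_ : 0 = - A * 0); last by rewrite mulr0.
  apply: cvgMr.
  have L : xi ^+ 2 * k @[xi --> +oo] --> +oo.
    apply/cvgryPge => M; near=> xi.
    have xi1 : 1 <= xi by near: xi; exact: nbhs_pinfty_ge.
    have : M / k <= xi by near: xi; apply: nbhs_pinfty_ge; exact: num_real.
    rewrite ler_pdivrMr// => /le_trans; apply.
    rewrite ler_wpM2r; first by [].
      exact: ltW.
    by rewrite ler_eXnr.
  have := cvg_comp _ _ L (@cvgr_expR R).
  exact.
Unshelve. all: by end_near. Qed.

Let integrable_sq : mu.-integrable (`]x, +oo[%classic : set R) (EFin \o (fun xi => xi ^- 2)).
Proof.
have d (xi : R) : x < xi -> is_derive xi 1 (fun xi => - xi^-1) (xi ^- 2).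
  move=> xxi; have xi0 : xi != 0 by rewrite gt_eqF// (lt_trans x0).
  have dV := is_derive1V (f := id) xi0 (is_derive_id xi 1).
  by apply: (is_derive_eq (is_derive1N dV)); rewrite mulN1r opprK.
apply: (@integrable_oy _ x (fun xi => - xi^-1) _ _ d x^-1).
- move=> xi xxi; have xi0 : xi != 0 by rewrite gt_eqF// (lt_trans x0).
  apply: (@continuousV _ _ (fun xi : R => xi ^+ 2)); first by rewrite expf_neq0.
  exact: exprn_continuous.
- by move=> xi _; rewrite invr_ge0 sqr_ge0.
- move=> xi xxi; have xi0 := lt_trans x0 xxi.
  by rewrite normrN ger0_norm ?invr_ge0 ?ltW// ltf_pV2.
Qed.

Let integrable_rsqrt :
  mu.-integrable (`]0, t[%classic : set R) (EFin \o (fun tau => (t - tau) `^ (- (1 / 2)))).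
Proof.
have pos (tau : R) : 0 < tau < t -> 0 < t - tau by move=> /andP[_]; rewrite subr_gt0.
have d (tau : R) : 0 < tau < t ->
    is_derive tau 1 (fun tau => - (2 * (t - tau) `^ (1 / 2))) ((t - tau) `^ (- (1 / 2))).
  move=> /pos tau0; derive1_to.
  rewrite (_ : 1 / 2 - 1 = - (1 / 2)); last by field.
  by move: (_ `^ _) (_ `^ _) => P Q; field.
apply: (@integrable_oo _ 0 t _ _ t0 _ d (2 * t `^ (1 / 2))).
- by move=> tau /pos tau0; derive1_cont.
- by move=> tau _; exact: powR_ge0.
- move=> tau /andP[tau0 taut]; rewrite normrN ger0_norm ?mulr_ge0 ?powR_ge0//.
  by rewrite ler_wpM2l// ge0_ler_powR ?nnegrE//; lra.
Qed.

(** For alpha in [1/2, 1[ the order alpha / 2 lies in [1/4, 1/2[, where the bounds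
   on the kernel are uniform. *)
Lemma cvg_c5 (T : R) (g : R -> R) : t < T -> {within `[0, T[, continuous g} ->
  c5 lambda g alpha x t @[alpha --> 1^'-] --> heat_sol lambda g x t.
Proof.
move=> tT gc; apply/cvg_at_leftP => alpha [alpha1 alphal].
have /(_ t tT)[K K0 gK] := continuous_segment_bounded gc.
(* discard the finitely many terms below 1/2 *)
have [N HN] : exists N, forall n, 1 / 2 <= alpha (n + N)%N.
  have : \forall n \near \oo, 1 / 2 <= alpha n.
    by apply: (cvgr_ge _ alphal); lra.
  by move=> [N _ HN]; exists N => n; apply: HN; rewrite /= leq_addl.
rewrite -(cvg_shiftn N) /=.
pose nu n := alpha (n + N)%N / 2.
have nuP n : 1 / 4 <= nu n < 1 / 2.
  by rewrite /nu; have := HN n; have := alpha1 (n + N)%N; lra.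
have nul : nu n @[n --> \oo] --> (1 / 2 : R).
  by apply: cvgMl; rewrite (cvg_shiftn N alpha).
pose A : set R := `]x, +oo[%classic.
pose B : set R := `]0, t[%classic.
pose f (p : R * R) : R := p.1 / (2 * lambda * Num.sqrt pi * (t - p.2) `^ (3 / 2)) *
   expR (- (p.1 ^+ 2 / (4 * lambda ^+ 2 * (t - p.2)))) * g p.2.
have BP tau : B tau -> 0 < tau < t /\ 0 < t - tau.
  by rewrite /B/= in_itv/= => ?; split => //; lra.
have AP xi : A xi -> 0 < xi by rewrite /A/= in_itv/= andbT; exact: lt_trans.
have mg : measurable_fun B g.
  apply: (measurable_boundary_data gc tT); first exact: measurable_itv.
  by move=> tau /BP[]; lra.
have -> : heat_sol lambda g x t =
    - \int[mu]_(tau in B) \int[mu]_(xi in A) f (xi, tau).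
  rewrite /heat_sol mulNr -RintegralZl//; last first.
    have [C C0 HC] := heat_kernel_derivs_bounded l0 x x0.
    apply: (@integrable_convolution _ _ _ (heat_kernel lambda x) C _ _ gc tT) => [s _|s].
      exact: (is_derive1_continuous (is_derive_heat_kernel_s l0 s x0)).
    by have [] := HC x s; first by rewrite !lexx.
  congr (- _); apply: eq_Rintegral => tau /set_mem/BP[_ tau0].
  rewrite /f/= mulrA; have [ih <-] := integral_gauss_flux tau0.
  by apply/esym/RintegralZr => //; exact: measurable_itv.
apply: cvgN.
apply: (@dominated_cvg_iterated _ A B (fun xi => xi ^- 2)
  (fun tau => 192 * lambda ^+ 2 * K * (1 + (t - tau) `^ (- (1 / 2))))
  (fun n p => flux_kernel (nu n) p.1 (t - p.2) * g p.2)).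
- exact: measurable_itv.
- exact: measurable_itv.
- exact: integrable_sq.
- apply: integrableZlR; last exact: measurable_itv.
  apply: integrableDR; last exact: measurable_itv.
    exact: integrable_cst_oo.
  exact: integrable_rsqrt.
- move=> n; apply: measurable_funM.
    by apply: measurable_flux_kernel; have := nuP n; lra.
  apply: (@measurable_comp _ _ _ _ _ _ B) => //; first exact: measurable_itv.
    by move=> _ [[xi tau] [_ Btau] <-].
  by apply: measurable_funTS; exact: measurable_snd.
- move=> n xi tau /AP xi0 /BP[tauB tau0] /=; rewrite normrM.
  rewrite (_ : xi ^- 2 * _ =
    xi ^- 2 * (192 * lambda ^+ 2 * (1 + (t - tau) `^ (- (1 / 2)))) * K); last by ring.
  apply: ler_pM => //; first exact: flux_kernel_bound.
  by apply: gK; lra.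
- move=> xi tau /AP xi0 /BP[_ tau0] /=; apply: cvgMl.
  exact: cvg_flux_kernel.
Qed.

End fractional_limit.

(** * The heat problem *)

Section heat_problem.
Context {R : realType}.
Local Notation mu := (@lebesgue_measure R).
Variables (lambda T : R) (g : R -> R).
Hypotheses (l0 : 0 < lambda) (T0 : 0 < T).
Hypothesis gc : {within `[0, T[, continuous g}.

Lemma is_derive_under_integral (psi dpsi : R -> R -> R) (C b u v p : R) :
  b < T -> u < p < v ->
  (forall q : R, u < q < v -> mu.-integrable `]0, b[ (EFin \o (fun tau => psi q tau * g tau))) ->
  (forall q tau : R, u < q < v -> is_derive q 1 (psi ^~ tau) (dpsi q tau)) ->
  (forall q tau : R, u < q < v -> `|dpsi q tau| <= C) ->
  is_derive p 1 (fun q => \int[mu]_(tau in `]0, b[) (psi q tau * g tau))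
    (\int[mu]_(tau in `]0, b[) (dpsi p tau * g tau)).
Proof.
move=> bT puv ipsi dp dpC; have /(_ b bT)[K K0 gK] := continuous_segment_bounded gc.
have C0 : 0 <= C by apply: le_trans (dpC p 0 puv).
pose f q tau := psi q tau * g tau.
have df (q tau : R) : u < q < v -> is_derive q 1 (f ^~ tau) (dpsi q tau * g tau).
  move=> quv; have d := dp q tau quv.
  by rewrite /f; derive1_to; rewrite /=; ring.
have mB : measurable (`]0, b[%classic : set R) by exact: measurable_itv.
have Ip : `]u, v[%classic p by rewrite /= in_itv.
have intf (q : R) : `]u, v[%classic q -> mu.-integrable `]0, b[ (EFin \o f q).
  by rewrite /= in_itv; exact: ipsi.
have derf (q tau : R) : `]u, v[%classic q -> `]0, b[%classic tau -> derivable (f ^~ tau) q 1.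
  by rewrite /= in_itv/= => quv _; have [] := df q tau quv.
have p1 (q tau : R) : u < q < v -> partial1of2 f q tau = dpsi q tau * g tau.
  by move=> quv; rewrite partial1of2E; have [] := df q tau quv.
have G0 (tau : R) : 0 <= (fun=> C * K) tau by rewrite mulr_ge0// ltW.
have fG (q tau : R) : `]u, v[%classic q -> `]0, b[%classic tau -> `|partial1of2 f q tau| <= C * K.
  rewrite /= !in_itv/= => quv /andP[/ltW tau0 /ltW taub]; rewrite p1// normrM.
  by apply: ler_pM => //; [exact: dpC|rewrite gK// tau0].
have iG := @integrable_cst_oo R 0 b (C * K).
pose B : set R := `]0, b[%classic.
split; first exact: (@derivable_under_integral R _ _ mu f B mB p u v Ip intf derf _ G0 iG fG).
rewrite -derive1E.
rewrite (@differentiation_under_integral R _ _ mu f B mB p u v Ip intf derf _ G0 iG fG).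
by apply: eq_Rintegral => tau _; rewrite p1.
Qed.

Let H := heat_kernel lambda.

Let cont_H (x s : R) : 0 < x -> {for s, continuous (H x)}.
Proof. by move=> x0; exact: (is_derive1_continuous (is_derive_heat_kernel_s l0 s x0)). Qed.

Let cont_Hx (x s : R) : 0 < x -> 0 < s -> {for s, continuous (heat_kernel_x lambda x)}.
Proof.
move=> x0 s0; have d := is_derive_heat_kernel_s l0 s x0.
have dV := is_derive1V (f := id) (lt0r_neq0 s0) (is_derive_id s 1).
by rewrite /heat_kernel_x; derive1_cont.
Qed.

Let cont_Hxx (x s : R) : 0 < x -> 0 < s -> {for s, continuous (heat_kernel_xx lambda x)}.
Proof.
move=> x0 s0; have d := is_derive_heat_kernel_s l0 s x0.
have dV := is_derive1V (f := id) (lt0r_neq0 s0) (is_derive_id s 1).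
by rewrite /heat_kernel_xx; derive1_cont.
Qed.

Let HC (u v : R) : 0 < u -> exists C : R, forall x s : R, u < x < v ->
  [/\ `|H x s| <= C, `|heat_kernel_x lambda x s| <= C,
      `|heat_kernel_xx lambda x s| <= C & `|heat_kernel_s lambda x s| <= C].
Proof.
move=> u0; have [C _ HC] := heat_kernel_derivs_bounded l0 v u0.
by exists C => x s /andP[/ltW ux /ltW xv]; apply: HC; rewrite ux.
Qed.

Lemma is_derive_heat_sol_x (x t : R) : 0 < x -> t < T ->
  is_derive x 1 (heat_sol lambda g ^~ t)
    (- lambda * \int[mu]_(tau in `]0, t[) (heat_kernel_x lambda x (t - tau) * g tau)).
Proof.
move=> x0 tT; have [|C hC] := @HC (x / 2) (x * 2); first by lra.
have d := @is_derive_under_integral (fun y tau => H y (t - tau))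
  (fun y tau => heat_kernel_x lambda y (t - tau)) C t (x / 2) (x * 2) x tT.
have {}d : is_derive x 1 (fun y => \int[mu]_(tau in `]0, t[) (H y (t - tau) * g tau))
    (\int[mu]_(tau in `]0, t[) (heat_kernel_x lambda x (t - tau) * g tau)).
  apply: d; first lra.
  - move=> q qx; apply: (@integrable_convolution _ _ _ (H q) C _ _ gc tT) => [s _|s].
      by apply: cont_H; lra.
    by have [] := hC q s qx.
  - by move=> q tau _; exact: is_derive_heat_kernel_x.
  - by move=> q tau qx; have [] := hC q (t - tau) qx.
rewrite /heat_sol -/H.
by derive1_to; rewrite /=; ring.
Qed.

Lemma is_derive_heat_sol_xx (x t : R) : 0 < x -> t < T ->
  is_derive x 1 (derive1 (heat_sol lambda g ^~ t))
    (- lambda * \int[mu]_(tau in `]0, t[) (heat_kernel_xx lambda x (t - tau) * g tau)).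
Proof.
move=> x0 tT; have [|C hC] := @HC (x / 2) (x * 2); first by lra.
have d := @is_derive_under_integral (fun y tau => heat_kernel_x lambda y (t - tau))
  (fun y tau => heat_kernel_xx lambda y (t - tau)) C t (x / 2) (x * 2) x tT.
have {}d : is_derive x 1 (fun y => \int[mu]_(tau in `]0, t[) (heat_kernel_x lambda y (t - tau) * g tau))
    (\int[mu]_(tau in `]0, t[) (heat_kernel_xx lambda x (t - tau) * g tau)).
  apply: d; first lra.
  - move=> q qx; apply: (@integrable_convolution _ _ _ (heat_kernel_x lambda q) C _ _ gc tT) => [s sP|s].
      by apply: cont_Hx; lra.
    by have [] := hC q s qx.
  - by move=> q tau _; exact: is_derive_heat_kernel_xx.
  - by move=> q tau qx; have [] := hC q (t - tau) qx.
have {}d : is_derive x 1 (fun y => - lambda * \int[mu]_(tau in `]0, t[) (heat_kernel_x lambda y (t - tau) * g tau))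
    (- lambda * \int[mu]_(tau in `]0, t[) (heat_kernel_xx lambda x (t - tau) * g tau)).
  by derive1_to; rewrite /=; ring.
apply: (near_eq_is_derive _ d); near=> y.
have y0 : 0 < y by near: y; exact: lt_nbhsr.
by rewrite derive1E; have [] := is_derive_heat_sol_x y0 tT.
Unshelve. all: by end_near. Qed.

(** Causality: the upper limit t may be replaced by any larger b, which frees the
   domain of integration from the variable of differentiation. *)
Lemma Rintegral_convolution_support (phi : R -> R) (b t : R) : t <= b ->
  (forall s : R, s <= 0 -> phi s = 0) ->
  \int[mu]_(tau in `]0, b[) (phi (t - tau) * g tau) =
  \int[mu]_(tau in `]0, t[) (phi (t - tau) * g tau).
Proof.
move=> tb phi0.
rewrite [LHS]Rintegral_mkcond [RHS]Rintegral_mkcond; apply: eq_Rintegral => tau _.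
rewrite !patchE; case: ifPn; case: ifPn => //; rewrite ?inE/= ?in_itv/=.
- move=> /negP; rewrite inE /= in_itv /= => H1 /andP[tau0 _].
  by rewrite phi0 ?mul0r// subr_le0 leNgt; apply/negP => H2; apply: H1; rewrite tau0.
- move=> /andP[tau0 taut] /negP; rewrite inE/= in_itv/= tau0 (lt_le_trans taut)//.
Qed.

Lemma is_derive_heat_sol_t (x t : R) : 0 < x -> 0 < t < T ->
  is_derive t 1 (heat_sol lambda g x)
    (- lambda * \int[mu]_(tau in `]0, t[) (heat_kernel_s lambda x (t - tau) * g tau)).
Proof.
move=> x0 tT; have [|C hC] := @HC (x / 2) (x * 2); first by lra.
(* any b strictly between t and T would do *)
pose b := (t + T) / 2.
have bT : b < T by rewrite /b; lra.
have tb : t < b by rewrite /b; lra.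
have xx : x / 2 < x < x * 2 by lra.
have d := @is_derive_under_integral (fun t tau => H x (t - tau))
  (fun t tau => heat_kernel_s lambda x (t - tau)) C b 0 b t bT.
have {}d : is_derive t 1 (fun t => \int[mu]_(tau in `]0, b[) (H x (t - tau) * g tau))
    (\int[mu]_(tau in `]0, b[) (heat_kernel_s lambda x (t - tau) * g tau)).
  apply: d; first lra.
  - move=> q _; apply: (@integrable_convolution _ _ _ (H x) C _ _ gc bT) => [s _|s].
      exact: cont_H.
    by have [] := hC x s xx.
  - move=> q tau _; have d1 := is_derive_heat_kernel_s l0 (q - tau) x0.
    have d2 := is_derive1B (is_derive_id q 1) (is_derive_cst tau q 1).
    have d3 := @is_derive1_comp _ (H x) (fun q => q - tau) q _ _ d1 d2.
    by apply: (is_derive_eq d3); rewrite subr0 mulr1.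
  - by move=> q tau _; have [] := hC x (q - tau) xx.
have Hs0 (s : R) : s <= 0 -> heat_kernel_s lambda x s = 0.
  by move=> s0; rewrite /heat_kernel_s heat_kernel_le0// mulr0.
rewrite -(Rintegral_convolution_support (ltW tb) Hs0).
have {}d : is_derive t 1 (fun t => - lambda * \int[mu]_(tau in `]0, b[) (H x (t - tau) * g tau))
    (- lambda * \int[mu]_(tau in `]0, b[) (heat_kernel_s lambda x (t - tau) * g tau)).
  by derive1_to; rewrite /=; ring.
apply: (near_eq_is_derive _ d); near=> y.
rewrite /heat_sol -/H (@Rintegral_convolution_support (H x))//.
  by apply: ltW; near: y; exact: lt_nbhsl.
by move=> s; exact: heat_kernel_le0.
Unshelve. all: by end_near. Qed.

Lemma heat_sol_heat (x t : R) : 0 < x -> 0 < t < T ->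
  [/\ derivable (heat_sol lambda g x) t 1, derivable2 (heat_sol lambda g ^~ t) x &
      derive1 (heat_sol lambda g x) t = lambda ^+ 2 * derive1n 2 (heat_sol lambda g ^~ t) x].
Proof.
move=> x0 tP; have tT : t < T by lra.
have [dt Et] := is_derive_heat_sol_t x0 tP.
have [dxx Exx] := is_derive_heat_sol_xx x0 tT.
split=> //.
  split=> //; near=> y; have y0 : 0 < y by near: y; exact: lt_nbhsr.
  by have [] := is_derive_heat_sol_x y0 tT.
rewrite derive1E Et /= [X in _ = _ * X]derive1E Exx mulrCA; congr (_ * _).
rewrite -RintegralZl//.
  by apply: eq_Rintegral => tau _; rewrite heat_kernel_heat// mulrA.
have [|C hC] := @HC (x / 2) (x * 2); first by lra.
apply: (@integrable_convolution _ _ _ (heat_kernel_xx lambda x) C _ _ gc tT) => [s sP|s].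
  by apply: cont_Hxx; lra.
by have [] := hC x s; first lra.
Unshelve. all: by end_near. Qed.

Lemma Rintegral_cst_oo (a b c : R) : a <= b -> \int[mu]_(x in `]a, b[) c = c * (b - a).
Proof.
move=> ab; rewrite Rintegral_cst; last exact: measurable_itv.
rewrite /= lebesgue_measure_itv/= lte_fin; case: ltP => //= ba.
by rewrite (_ : b = a) ?subrr//; apply/eqP; rewrite eq_le ba ab.
Qed.

Lemma normr_Rintegral_le (f : R -> R) (a b M : R) : a <= b ->
  mu.-integrable `]a, b[ (EFin \o f) ->
  (forall x : R, a < x < b -> `|f x| <= M) ->
  `|\int[mu]_(x in `]a, b[) f x| <= M * (b - a).
Proof.
move=> ab fi fM; rewrite -Rintegral_cst_oo//.
apply: (le_trans (le_normr_Rintegral _ fi)); first exact: measurable_itv.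
apply: (le_Rintegral _ (integrable_norm fi) (integrable_cst_oo _ _ M)).
- exact: measurable_itv.
- by move=> x; rewrite /= in_itv; exact: fM.
Qed.

(** The kernel is bounded for fixed x > 0, so the integral over ]0, t[ is O(t). *)
Lemma heat_sol_initial : zero_initial_value (heat_sol lambda g).
Proof.
move=> x x0; have [|C hC] := @HC (x / 2) (x * 2); first by lra.
have b0 : T / 2 < T by rewrite ltr_pdivrMr// ltr_pMr// ltr1n.
have /(_ _ b0)[K K0 gK] := continuous_segment_bounded gc.
have xx : x / 2 < x < x * 2 by lra.
have C0 : 0 <= C by have [+ _ _ _] := hC x 0 xx; apply: le_trans.
have bound (t : R) : 0 < t < T / 2 -> `|heat_sol lambda g x t| <= lambda * C * K * t.
  move=> /andP[t0 tT]; rewrite /heat_sol normrM normrN (gtr0_norm l0) -!mulrA ler_wpM2l//.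
    exact: ltW.
  have B : `|\int[mu]_(tau in `]0, t[) (H x (t - tau) * g tau)| <= C * K * (t - 0).
    apply: normr_Rintegral_le; first exact: ltW.
      apply: (@integrable_convolution _ _ _ (H x) C _ _ gc) => [|s _|s]; first lra.
        exact: cont_H.
      by have [] := hC x s xx.
    move=> tau /andP[tau0 taut]; rewrite normrM; apply: ler_pM => //.
      by have [] := hC x (t - tau) xx.
    by apply: gK; lra.
  by rewrite subr0 in B; rewrite mulrA.
apply: (@squeeze_cvgr _ _ _ _ (fun t => - (lambda * C * K * t)) (fun t => lambda * C * K * t)).
- near=> t; rewrite -ler_norml; apply: bound; apply/andP; split.
    by near: t; exact: nbhs_right_gt.
  by near: t; apply: nbhs_right_lt; rewrite divr_gt0.
- apply: cvg_at_right_filter; rewrite -[X in _ --> X]oppr0; apply: cvgN.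
  by rewrite -[X in _ --> X](mulr0 (lambda * C * K)); apply: cvgMr; exact: cvg_id.
- apply: cvg_at_right_filter.
  by rewrite -[X in _ --> X](mulr0 (lambda * C * K)); apply: cvgMr; exact: cvg_id.
Unshelve. all: by end_near. Qed.

Local Notation gauss_area := (@gauss_integral_proof.integral0_gauss R).

Let gauss_area_ge0 (y : R) : 0 <= gauss_area y.
Proof. exact: gauss_integral_proof.integral0_gauss_ge0. Qed.

Let gauss_area_le (y : R) : 0 <= y -> gauss_area y <= y.
Proof.
move=> y0; rewrite /gauss_integral_proof.integral0_gauss.
have i : mu.-integrable `[0, y] (EFin \o gauss_fun).
  by apply: integrable_segment => x _; exact: continuous_gauss_fun.
have i1 : mu.-integrable `[0, y] (EFin \o (fun=> 1)).
  by apply: integrable_segment => x _; exact: cst_continuous.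
apply: le_trans (le_Rintegral _ i i1 _) _.
- exact: measurable_itv.
- by move=> x _; exact: gauss_fun_le1.
rewrite Rintegral_cst; last exact: measurable_itv.
by rewrite /= lebesgue_measure_itv/= lte_fin; case: ltP => _ /=; rewrite ?mulr0 ?mul1r ?subr0.
Qed.

Let is_derive_gauss_area (y : R) : 0 < y -> is_derive y 1 gauss_area (gauss_fun y).
Proof.
move=> y0; have yy : y < y + 1 by rewrite ltrDl.
have i : mu.-integrable `[0, y + 1] (EFin \o gauss_fun).
  by apply: integrable_segment => x _; exact: continuous_gauss_fun.
have [d E] := continuous_FTC1_closed yy i y0 (@continuous_gauss_fun R y).
by split; [exact: d|rewrite -derive1E; exact: E].
Qed.

Let cvg_gauss_area : gauss_area y @[y --> +oo] --> Num.sqrt pi / 2.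
Proof.
have : Num.sqrt (gauss_area y ^+ 2) @[y --> +oo] --> Num.sqrt (pi / 4).
  apply: continuous_cvg; first exact: sqrt_continuous.
  exact: gauss_integral_proof.cvg_integral0_gauss_sqr.
rewrite sqrtrM ?pi_ge0// sqrtrV// (_ : 4 = 2 ^+ 2); last by rewrite expr2 -natrM.
rewrite sqrtr_sqr ger0_norm// (_ : (fun _ => Num.sqrt _) = gauss_area)//.
by apply/funext => r; rewrite sqrtr_sqr ger0_norm.
Qed.

(** The kernel carrying the boundary flux g to the flux w_x at x: an approximate
   identity as x tends to 0. *)
Definition heat_flux (x s : R) : R := - lambda * heat_kernel_x lambda x s.

(** In this form the kernel is visibly the derivative, in tau, of
   (2 / sqrt pi) times the Gauss integral up to x (t - tau)^(-1/2) / (2 lambda). *)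
Lemma heat_fluxE (x s : R) : 0 < s ->
  heat_flux x s = 2 / Num.sqrt pi * (gauss_fun (x / (2 * lambda) * s `^ (- (1 / 2))) *
    (x / (2 * lambda) * (1 / 2 * s `^ (- (1 / 2) - 1)))).
Proof.
move=> s0; rewrite /heat_flux /heat_kernel_x (heat_kernelE lambda x s0) /gauss_fun.
have ss : s `^ (- (1 / 2)) * s `^ (- (1 / 2)) = s^-1.
  by rewrite -powR_add// (_ : _ + _ = -1) ?powR_inv1 ?ltW//; field.
have -> : (x / (2 * lambda) * s `^ (- (1 / 2))) ^+ 2 =
    (4 * lambda ^+ 2)^-1 * x ^+ 2 * s `^ (- 1).
  rewrite exprMn [(s `^ _) ^+ 2]expr2 ss powR_inv1; last exact: ltW.
  by move: (s^-1) => p; field; rewrite gt_eqF.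
rewrite powR_add// powR_inv1; last exact: ltW.
have l1 : lambda != 0 by rewrite gt_eqF.
have s1 : s != 0 by rewrite gt_eqF.
have q0 : Num.sqrt pi != 0 :> R by rewrite gt_eqF// sqrtr_gt0 pi_gt0.
by field; rewrite s1 q0 l1.
Qed.

Let heat_flux_ge0 (x s : R) : 0 < x -> 0 < s -> 0 <= heat_flux x s.
Proof.
move=> x0 s0; rewrite /heat_flux /heat_kernel_x mulrA mulrNN.
apply: mulr_ge0; last exact: heat_kernel_ge0.
have kk : 0 <= (4 * lambda ^+ 2)^-1 by rewrite invr_ge0; apply: mulr_ge0 => //; exact: sqr_ge0.
apply: mulr_ge0; first exact: ltW.
apply: mulr_ge0; last by rewrite invr_ge0 ltW.
by apply: mulr_ge0; [exact: mulr_ge0|exact: ltW].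
Qed.

Let integrable_heat_flux_mul (x t : R) (h : R -> R) : 0 < x -> t < T ->
  {within `[0, T[, continuous h} ->
  mu.-integrable `]0, t[ (EFin \o (fun tau => heat_flux x (t - tau) * h tau)).
Proof.
move=> x0 tT ch; have [|C hC] := @HC (x / 2) (x * 2); first by lra.
apply: (@integrable_convolution _ _ _ (heat_flux x) (lambda * C) _ _ ch tT) => [s sP|s].
  have s0 : 0 < s by lra.
  by apply: continuousM; [exact: cst_continuous|exact: cont_Hx].
rewrite /heat_flux normrM normrN (gtr0_norm l0) ler_wpM2l//; first exact: ltW.
by have [] := hC x s; first lra.
Qed.

Let integrable_heat_flux (x t : R) : 0 < x -> t < T ->
  mu.-integrable `]0, t[ (EFin \o (fun tau => heat_flux x (t - tau))).
Proof.
move=> x0 tT; have := @integrable_heat_flux_mul x t (fun=> 1) x0 tT.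
rewrite (_ : (fun tau => _ * 1) = (fun tau => heat_flux x (t - tau))); last first.
  by apply/funext => tau; rewrite mulr1.
by apply; apply: continuous_subspaceT; exact: cst_continuous.
Qed.

(** The primitive tends to the full Gauss integral as tau tends to t; the mass
   missing from 1 is the value of the primitive at tau = 0. *)
Lemma heat_flux_mass (x t : R) : 0 < x -> 0 < t < T ->
  \int[mu]_(tau in `]0, t[) heat_flux x (t - tau) =
  1 - 2 / Num.sqrt pi * gauss_area (x / (2 * lambda) * t `^ (- (1 / 2))).
Proof.
move=> x0 /andP[t0 tT]; pose c := x / (2 * lambda).
have c0 : 0 < c by rewrite divr_gt0// mulr_gt0.
pose G tau := 2 / Num.sqrt pi * gauss_area (c * (t - tau) `^ (- (1 / 2))).
have pos (tau : R) : 0 < tau < t -> 0 < t - tau by lra.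
have q0 : Num.sqrt pi != 0 :> R by rewrite gt_eqF// sqrtr_gt0 pi_gt0.
have d2 (tau : R) : 0 < t - tau -> is_derive tau 1 (fun tau => c * (t - tau) `^ (- (1 / 2)))
    (c * (1 / 2 * (t - tau) `^ (- (1 / 2) - 1))).
  by move=> tau0; derive1_to; rewrite /=; ring.
have d3 (tau : R) : 0 < t - tau -> is_derive tau 1 G (heat_flux x (t - tau)).
  move=> tau0; have d1 : is_derive (c * (t - tau) `^ (- (1 / 2))) 1 gauss_area
      (gauss_fun (c * (t - tau) `^ (- (1 / 2)))).
    by apply: is_derive_gauss_area; rewrite mulr_gt0// powR_gt0.
  have d := @is_derive1_comp _ gauss_area (fun tau => c * (t - tau) `^ (- (1 / 2))) _ _ _ d1 (d2 _ tau0).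
  rewrite /G heat_fluxE//; derive1_to; rewrite -/c /=; ring.
rewrite (@FTC_oo _ 0 t G _ t0 _ _ (G 0) 1).
- by rewrite /G subr0.
- move=> tau /pos tau0.
  apply: (@continuous_comp _ _ _ (fun tau => t - tau) (heat_flux x)).
    by apply: continuousB; [exact: cst_continuous|exact: id].
  by apply: continuousM; [exact: cst_continuous|exact: cont_Hx].
- by move=> tau /pos; exact: d3.
- exact: integrable_heat_flux.
- apply: cvg_at_right_filter; apply: (is_derive1_continuous (d3 0 _)); lra.
- rewrite [X in _ --> X](_ : 1 = 2 / Num.sqrt pi * (Num.sqrt pi / 2)); last first.
    by move: (Num.sqrt pi) q0 => Q Q0; field.
  apply: cvgMr.
  have L : c * (t - tau) `^ (- (1 / 2)) @[tau --> t^'-] --> +oo.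
    have S : c^-1 * Num.sqrt (t - tau) @[tau --> t^'-] --> (0 : R).
      apply: cvg_at_left_filter.
      rewrite [X in _ --> X](_ : 0 = c^-1 * Num.sqrt (t - t)); last by rewrite subrr sqrtr0 mulr0.
      apply: cvgMr; apply: (@continuous_comp _ _ _ (fun tau => t - tau) Num.sqrt).
        by apply: continuousB; [exact: cst_continuous|exact: id].
      exact: sqrt_continuous.
    have P : \forall tau \near t^'-, 0 < c * (t - tau) `^ (- (1 / 2)).
      near=> tau; rewrite mulr_gt0// powR_gt0// subr_gt0.
      by near: tau; exact: nbhs_left_lt.
    apply/(gtr0_cvgV0 P); apply: cvg_trans S; apply: near_eq_cvg; near=> tau.
    have taut : 0 < t - tau by rewrite subr_gt0; near: tau; exact: nbhs_left_lt.
    change (c^-1 * Num.sqrt (t - tau) = (c * (t - tau) `^ (- (1 / 2)))^-1).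
    rewrite -(powR12_sqrt (ltW taut)) [RHS]invfM -[((t - tau) `^ (- (1 / 2)))^-1]powRN opprK.
    by rewrite (_ : 1 / 2 = 2^-1 :> R)//; field.
  exact: (cvg_comp _ _ L cvg_gauss_area).
Unshelve. all: by end_near. Qed.

Lemma cvg_heat_flux_mass (t : R) : 0 < t < T ->
  \int[mu]_(tau in `]0, t[) heat_flux x (t - tau) @[x --> 0^'+] --> (1 : R).
Proof.
move=> tP; pose D := t `^ (- (1 / 2)) / (2 * lambda).
have D0 : 0 <= D by rewrite divr_ge0 ?powR_ge0// mulr_ge0// ltW.
have q0 : 0 < Num.sqrt pi :> R by rewrite sqrtr_gt0 pi_gt0.
apply: (@squeeze_cvgr _ _ _ _ (fun x => 1 - 2 / Num.sqrt pi * (D * x)) (fun=> 1)).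
- near=> x; have x0 : 0 < x by near: x; exact: nbhs_right_gt.
  have y0 : 0 <= x / (2 * lambda) * t `^ (- (1 / 2)).
    by rewrite mulr_ge0 ?powR_ge0// divr_ge0 ?(ltW x0)// mulr_ge0// ltW.
  rewrite heat_flux_mass//; apply/andP; split.
    rewrite lerD2l lerN2 ler_wpM2l ?divr_ge0 ?(ltW q0)//.
    apply: le_trans (gauss_area_le y0) _; rewrite /D.
    by rewrite le_eqVlt; apply/orP; left; apply/eqP; ring.
  by rewrite gerBl mulr_ge0// divr_ge0// ltW.
- apply: cvg_at_right_filter.
  rewrite [X in _ --> X](_ : 1 = 1 - 2 / Num.sqrt pi * (D * 0)); last by rewrite !mulr0 subr0.
  by apply: cvgB; [exact: cvg_cst|apply: cvgMr; apply: cvgMr; exact: cvg_id].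
- exact: cvg_cst.
Unshelve. all: by end_near. Qed.

Lemma heat_flux_le_away (t d : R) : 0 < d -> exists2 D : R, 0 <= D &
  forall x s : R, 0 < x -> d <= s -> heat_flux x s <= D * x.
Proof.
move=> d0; pose k := (4 * lambda ^+ 2)^-1.
have kk : 0 <= k by rewrite invr_ge0; apply: mulr_ge0 => //; exact: sqr_ge0.
have lk : 0 <= lambda * (2 * k) by rewrite mulr_ge0// ?mulr_ge0// ltW.
have m0 : 0 <= d^-1 * (Num.sqrt (pi * d))^-1 by rewrite mulr_ge0// invr_ge0// ?sqrtr_ge0 ?ltW.
exists (lambda * (2 * k) * (d^-1 * (Num.sqrt (pi * d))^-1)); first exact: mulr_ge0.
move=> x s x0 ds; have s0 : 0 < s by apply: lt_le_trans ds.
rewrite /heat_flux /heat_kernel_x mulrA mulrNN -/k.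
rewrite (_ : lambda * (2 * k * x * s^-1) * heat_kernel lambda x s = lambda * (2 * k) * (s^-1 * heat_kernel lambda x s) * x); last by ring.
rewrite ler_wpM2r ?(ltW x0)// ler_wpM2l//.
apply: ler_pM; rewrite ?heat_kernel_ge0 ?invr_ge0 ?(ltW s0)//.
  by rewrite lef_pV2.
rewrite /heat_kernel -[leRHS]mul1r; apply: ler_pM; rewrite ?expR_ge0 ?invr_ge0 ?sqrtr_ge0//.
  by rewrite -[leRHS]expR0 ler_expR oppr_le0 divr_ge0 ?sqr_ge0// mulr_ge0 ?(ltW s0)// mulr_ge0 ?sqr_ge0.
rewrite lef_pV2 ?posrE ?sqrtr_gt0 ?mulr_gt0 ?pi_gt0//.
rewrite ler_sqrt; first by rewrite ler_wpM2l ?pi_ge0.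
by rewrite mulr_ge0 ?pi_ge0// ltW.
Qed.

(** Write the flux minus m(x) g(t), m(x) the mass of the kernel, as the integral
   of the kernel against g(tau) - g(t). This difference is small for tau near t
   by continuity of g, and elsewhere the kernel is O(x). *)
Lemma heat_sol_flux : boundary_flux T g (heat_sol lambda g).
Proof.
move=> t tP; have /andP[t0 tT] := tP.
have /(_ t tT)[K K0 gK] := continuous_segment_bounded gc.
have flux (x : R) : 0 < x -> derive1 (heat_sol lambda g ^~ t) x =
    \int[mu]_(tau in `]0, t[) (heat_flux x (t - tau) * g tau).
  move=> x0; rewrite derive1E; have [_ ->] := is_derive_heat_sol_x x0 tT.
  rewrite -RintegralZl//; first by apply: eq_Rintegral => tau _; rewrite mulrA.
  have [|C hC] := @HC (x / 2) (x * 2); first by lra.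
  apply: (@integrable_convolution _ _ _ (heat_kernel_x lambda x) C _ _ gc tT) => [s sP|s].
    by apply: cont_Hx; lra.
  by have [] := hC x s; first lra.
have cg := continuous_interior gc tP.
apply/cvgrPdist_le => e e0.
have [d d0 gd] : exists2 d : R, 0 < d & forall tau, `|t - tau| < d -> `|g tau - g t| <= e / 3.
  have e3 : 0 < e / 3 by rewrite divr_gt0.
  have /cvgrPdist_le/(_ _ e3)/nbhs_ballP[d /= d0 H3] := cg.
  by exists d => // tau td; rewrite distrC; apply: H3.
have [D D0 HD] := heat_flux_le_away t d0.
pose m x := \int[mu]_(tau in `]0, t[) heat_flux x (t - tau).
(* contributions of the times near t, of the other times and of the defect of
   mass, in this order *)
have main (x : R) : 0 < x -> `|g t - derive1 (heat_sol lambda g ^~ t) x| <=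
    e / 3 * m x + 2 * K * D * t * x + K * `|1 - m x|.
  move=> x0; rewrite flux//.
  have ik := integrable_heat_flux x0 tT; have ikg := integrable_heat_flux_mul x0 tT gc.
  have mB : measurable (`]0, t[%classic : set R) by exact: measurable_itv.
  have ikt : mu.-integrable `]0, t[ (EFin \o (fun tau => heat_flux x (t - tau) * g t)).
    rewrite (_ : (fun tau => _) = fun tau => g t * heat_flux x (t - tau)).
      exact: integrableZlR.
    by apply/funext => tau; rewrite mulrC.
  have id : mu.-integrable `]0, t[ (EFin \o (fun tau => heat_flux x (t - tau) * g tau - heat_flux x (t - tau) * g t)).
    exact: integrableBR.
  have E : \int[mu]_(tau in `]0, t[) (heat_flux x (t - tau) * g tau) =
      m x * g t + \int[mu]_(tau in `]0, t[) (heat_flux x (t - tau) * g tau - heat_flux x (t - tau) * g t).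
    by rewrite RintegralB// RintegralZr// addrC subrK.
  have B : `|\int[mu]_(tau in `]0, t[) (heat_flux x (t - tau) * g tau - heat_flux x (t - tau) * g t)|
      <= e / 3 * m x + 2 * K * D * x * t.
    have ie : mu.-integrable `]0, t[ (EFin \o (fun tau => e / 3 * heat_flux x (t - tau))).
      exact: integrableZlR.
    have ic := @integrable_cst_oo R 0 t (2 * K * D * x).
    have ib : mu.-integrable `]0, t[ (EFin \o (fun tau => e / 3 * heat_flux x (t - tau) + 2 * K * D * x)).
      exact: integrableDR.
    apply: (le_trans (le_normr_Rintegral _ id)) => //.
    apply: (le_trans (le_Rintegral _ (integrable_norm id) ib _)) => //.
      move=> tau; rewrite /= in_itv/= => /andP[tau0 taut].
      have s0 : 0 < t - tau by rewrite subr_gt0.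
      have k0 := heat_flux_ge0 x0 s0.
      rewrite -mulrBr normrM (ger0_norm k0).
      have [td|td] := ltP (t - tau) d.
        rewrite ler_wpDr//; first by rewrite !mulr_ge0// ltW.
        by rewrite mulrC ler_wpM2r// gd// gtr0_norm.
      rewrite ler_wpDl//; first by rewrite mulr_ge0// divr_ge0// ltW.
      rewrite (_ : 2 * K * D * x = D * x * (K + K)); last by ring.
      apply: ler_pM => //; first exact: HD.
      by rewrite (le_trans (ler_normB _ _))// lerD// gK ?(ltW tau0) ?(ltW taut) ?(ltW t0) ?lexx.
    have Ec := @Rintegral_cst_oo 0 t (2 * K * D * x) (ltW t0).
    rewrite subr0 in Ec; rewrite RintegralD//.
    by apply: lerD; [rewrite RintegralZl|rewrite -Ec].
  rewrite E opprD addrA (le_trans (ler_normB _ _))//.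
  rewrite (_ : g t - m x * g t = (1 - m x) * g t); last by rewrite mulrBl mul1r.
  rewrite normrM addrC.
  apply: lerD; first by apply: le_trans B _; rewrite le_eqVlt; apply/orP; left; apply/eqP; ring.
  by rewrite mulrC ler_wpM2r// gK ?(ltW t0) ?lexx.
have h0 : 0 < e / 3 + K by rewrite addr_gt0// divr_gt0.
have q0 : 0 < 2 * K * D * t + 1 by rewrite ltr_wpDl// !mulr_ge0// ltW.
near=> x; have x0 : 0 < x by near: x; exact: nbhs_right_gt.
apply: le_trans (main x x0) _.
have M1 : `|1 - m x| <= e / 3 / (e / 3 + K).
  near: x; have /cvgrPdist_le := cvg_heat_flux_mass tP; apply.
  by rewrite !divr_gt0.
have x1 : x <= e / 3 / (2 * K * D * t + 1).
  by near: x; apply: nbhs_right_le; rewrite !divr_gt0.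
have Mx : m x <= 1 + `|1 - m x|.
  by rewrite -lerBlDl -normrN opprB ler_norm.
move: M1; rewrite ler_pdivlMr// => M1.
move: x1; rewrite ler_pdivlMr// => x1.
have e3 : 0 < e / 3 by rewrite divr_gt0.
have : e / 3 * m x <= e / 3 * (1 + `|1 - m x|) by rewrite ler_wpM2l// ltW.
lra.
Unshelve. all: by end_near. Qed.

Theorem heat_sol_solves : solves_heat_problem lambda T g (heat_sol lambda g).
Proof.
by split; [exact: heat_sol_heat|exact: heat_sol_initial|exact: heat_sol_flux].
Qed.

End heat_problem.

Unset Implicit Arguments.
Set Strict Implicit.
Set Printing Implicit Defensive.

Theorem theorem6 (R : realType) (lambda T : R) (g : R -> R)
  (lambda_gt0 : 0 < lambda) (T_gt0 : 0 < T)
  (g_cont : {within `[0, T[, continuous g})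
  (c5_solution : forall alpha : R, 0 < alpha < 1 ->
     solves_fractional_problem alpha lambda T g (c5 lambda g alpha)) :
  (forall x t : R, 0 < x -> 0 < t < T ->
     c5 lambda g alpha x t @[alpha --> 1^'-] --> heat_sol lambda g x t) /\
  solves_heat_problem lambda T g (heat_sol lambda g).
Proof.
split; last exact: heat_sol_solves.
move=> x t x0 /andP[t0 tT]; exact: (cvg_c5 lambda_gt0 x0 t0 tT g_cont).
Qed.
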